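(* Let $r:\mathbb{R}^+\to\mathbb{R}^+_*$ be an increasing $C^\infty$ function and let $\Gamma$ be the surface of revolution with generating function $r$, endowed with its geodesic distance. If there exist $p>4$ and $c\in\mathbb{R}$ such that $$r(z)-r(0)=cz^p+o(z^p)\quad\text{as } z\to0,$$ then $$\beta_\Gamma\le\frac{6}{p+2}.$$ If for every $p\in\mathbb{N}$ $$r(z)-r(0)=o(z^p)\quad\text{as } z\to0,$$ then $$\beta_\Gamma=0 .$$
   Context: $\mathbb{R}^+=[0,+\infty[$ and $\mathbb{R}^+_*=\,]0,+\infty[$. The surface of revolution with generating function $r$ is the surface $\Gamma\subset\mathbb{R}^3$ parametrised by $X_\Gamma(\theta,z)=(r(z)\cos\theta,\,r(z)\sin\theta,\,z)$, $\theta\in\mathbb{S}^1$, $z\in\mathbb{R}^+$. It carries the Riemannian metric induced from $\mathbb{R}^3$, namely $r(z)^2d\theta^2+(1+r'(z)^2)dz^2$, and the associated geodesic distance $d_\Gamma$ (infimum of the lengths of curves in $\Gamma$). A symmetric function $f:S\times S\to\mathbb{R}$ on a set $S$ is a negative definite kernel if for every $n$, every $x_1,\dots,x_n\in S$ and every $c_1,\dots,c_n\in\mathbb{R}$ with $\sum_{i=1}^n c_i=0$, one has $\sum_{i,j=1}^n c_ic_jf(x_i,x_j)\le 0$. The fractional index of a metric space $(E,d)$ is the number $\beta_E\in[0,+\infty]$ (known to exist) such that for every $H>0$, the function $d^{2H}$ is a negative definite kernel if and only if $2H\le\beta_E$. *)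

(* Defs.v *)
From Stdlib Require Import Reals.
From Coquelicot Require Import Coquelicot.
Open Scope R_scope.

(* [D_in] is the derivative relative to [D]: one-sided at an endpoint of [D]
   that belongs to [D]. *)
Definition derivative_on (D : R -> Prop) (f f' : R -> R) : Prop :=
  forall x, D x -> D_in f f' D x.

Definition C1_on (D : R -> Prop) (f f' : R -> R) : Prop :=
  derivative_on D f f' /\ continuous_on D f'.

Definition smooth_on (D : R -> Prop) (f : R -> R) : Prop :=
  exists F : nat -> R -> R,
    (forall x, D x -> F 0%nat x = f x) /\
    (forall k, derivative_on D (F k) (F (S k))).

Definition nonneg_reals (z : R) : Prop := 0 <= z.

Definition unit_interval (t : R) : Prop := 0 <= t <= 1.

Definition revolution_param (r : R -> R) (theta z : R) : R * R * R :=
  (r z * cos theta, r z * sin theta, z).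

Definition revolution_surface (r : R -> R) (P : R * R * R) : Prop :=
  exists theta z, 0 <= z /\ P = revolution_param r theta z.

(* [curve_length S P Q l]: some piecewise C^1 curve in [S], i.e. a finite
   concatenation of C^1 arcs, joins [P] to [Q] and has length [l].  The
   Riemannian metric induced from R^3 measures a velocity by its Euclidean norm;
   for [revolution_param r] this is r^2 dtheta^2 + (1 + r'^2) dz^2. *)
Inductive curve_length (S : R * R * R -> Prop) :
    R * R * R -> R * R * R -> R -> Prop :=
| curve_arc (x y z x' y' z' : R -> R) :
    C1_on unit_interval x x' ->
    C1_on unit_interval y y' ->
    C1_on unit_interval z z' ->
    (forall t, unit_interval t -> S (x t, y t, z t)) ->
    curve_length S (x 0, y 0, z 0) (x 1, y 1, z 1)
      (RInt (fun t => sqrt (x' t ^ 2 + y' t ^ 2 + z' t ^ 2)) 0 1)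
| curve_concat (P Q T : R * R * R) (l m : R) :
    curve_length S P Q l -> curve_length S Q T m ->
    curve_length S P T (l + m).

(* [real] maps infinite values to 0; when [P] and [Q] are joined by a curve in
   [S] the infimum is a finite nonnegative number. *)
Definition geodesic_distance (S : R * R * R -> Prop) (P Q : R * R * R) : R :=
  real (Glb_Rbar (curve_length S P Q)).

(* Since [ln 0 = 0], [Rpower 0 a] is 1 and not 0. *)
Definition nonneg_power (x a : R) : R :=
  if Req_EM_T x 0 then 0 else Rpower x a.

Definition negative_definite_kernel {T : Type} (S : T -> Prop)
    (f : T -> T -> R) : Prop :=
  (forall x y, S x -> S y -> f x y = f y x) /\
  (forall (n : nat) (x : nat -> T) (c : nat -> R),
    (forall i, (1 <= i <= n)%nat -> S (x i)) ->
    sum_n_m c 1 n = 0 ->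
    sum_n_m (fun i => sum_n_m (fun j => c i * c j * f (x i) (x j)) 1 n) 1 n
      <= 0).

Definition is_fractional_index {T : Type} (E : T -> Prop) (d : T -> T -> R)
    (beta : Rbar) : Prop :=
  Rbar_le 0 beta /\
  forall H : R, 0 < H ->
    (negative_definite_kernel E (fun x y => nonneg_power (d x y) (2 * H)) <->
     Rbar_le (2 * H) beta).

(* [is_domin F g f] is [f = o(g)] along the filter [F]. *)
Definition little_o_at_0 (f g : R -> R) : Prop :=
  is_domin (at_right 0) g f.

(* Main.v *)
Require Import Defs.
From Stdlib Require Import Reals ZArith Lra Lia.
From Coquelicot Require Import Coquelicot.
Open Scope R_scope.

(** Why the theorem holds.  Near [z = 0] the surface is very close to a cylinder,
    and no positive power of the distance of a cylinder is negative definite: the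
    distance from a point has a kink along the opposite generating line, and this
    kink has the wrong sign.  A finite configuration detecting it is placed in a
    thin band above the parallel [z = 0]; it survives on the surface as long as
    the deviation from the cylinder is small compared with the kink.

    The configuration consists of [N] parallels, with [2 n] equidistant points
    with weights [(-1)^k] on each, [n] even.  The levels are spaced so that the
    grid is a square lattice of mesh [c = r 0 * PI / n], and its distances on the
    cylinder are [c * sqrt (m^2 + h^2)], [m] being counted around the circle.  Fix
    [0 < a <= 1].  For two levels at distance [h > 0], the alternating sum over [m]
    of the smooth even function [(m^2 + h^2)^(a/2)] has cancellations everywhere
    except at the kink [m = n], which contributes a positive multiple of [n^(a-1)];
    the remainder is controlled by third differences
    ([alternating_sum_third_differences]), and adds up over the levels to a square
    of a harmonic sum.  A level paired with itself contributes at least [-1],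
    because [m^a] is concave.  Over all pairs of levels the positive part,
    [N^2 n^(a-1)], beats the negative one, of order [N (ln n)^2], once [N] is a
    slightly larger power of [n] than [n^(1-a)] ([lattice_energy_lower_bound]).

    The geodesic distance [d] of the surface satisfies [d0 <= d <= d0 + eps], with
    [d0] the distance of the cylinder of radius [r 0] and [eps] a multiple of
    [r delta - r 0], [delta] being the height of the band ([grid_distance]).  The
    lower bound holds because [r >= r 0], so that radial projection onto the
    cylinder shrinks lengths; a polar angle is lifted along every curve for that.
    The upper bound comes from helices, and monotonicity of [r] replaces bounds on
    its derivative.  As distinct points have [d0 >= c], each term [d^a] changes by
    at most [c^(a-1) eps].

    With [N] of order [n^(1-a/2)] the height [delta] is of order [n^(-a/2)], hence
    [eps] is of order [n^(-ap/2)], and comparing with the kink leaves the condition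
    [a p / 2 > 3 - a], that is [a > 6 / (p + 2)].  Every such [a <= 1] is excluded
    ([not_negative_definite_of_flat]), which bounds the index.  In the flat case
    this holds for every integer [p > 4], and [6 / (p + 2)] tends to 0. *)

(** * Finite sums *)

(** The terms of [sum_n_m] live in the carrier of an abelian monoid; taking the
    difference of both sides brings an equation back to [R], where [ring] works. *)
Ltac ring_R := apply Rminus_diag_uniq; ring.

Lemma sum_first_last (f : nat -> R) n :
  sum_n_m f 1 (S n) = sum_n_m f 1 n + f (S n).
Proof. rewrite sum_n_Sm; [reflexivity | lia]. Qed.

Lemma sum_empty (f : nat -> R) : sum_n_m f 1 0 = 0.
Proof. rewrite sum_n_m_zero; [reflexivity | lia]. Qed.

Lemma sum_head (f : nat -> R) n :
  sum_n_m f 1 (S n) = f 1%nat + sum_n_m (fun k => f (S k)) 1 n.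
Proof. rewrite sum_Sn_m; [rewrite sum_n_m_S; reflexivity | lia]. Qed.

Lemma sum_add (f g : nat -> R) n :
  sum_n_m (fun k => f k + g k) 1 n = sum_n_m f 1 n + sum_n_m g 1 n.
Proof. exact (sum_n_m_plus f g 1 n). Qed.

Lemma sum_mult_l (a : R) (f : nat -> R) n :
  sum_n_m (fun k => a * f k) 1 n = a * sum_n_m f 1 n.
Proof. exact (sum_n_m_mult_l (K := R_Ring) a f 1 n). Qed.

Lemma sum_le (f g : nat -> R) n :
  (forall k, (1 <= k <= n)%nat -> f k <= g k) ->
  sum_n_m f 1 n <= sum_n_m g 1 n.
Proof.
  induction n as [|n IH]; intros H.
  - rewrite !sum_empty; lra.
  - rewrite !sum_first_last.
    apply Rplus_le_compat; [apply IH; intros; apply H; lia | apply H; lia].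
Qed.

Lemma sum_const (a : R) n : sum_n_m (fun _ => a) 1 n = INR n * a.
Proof. rewrite sum_n_m_const. do 2 f_equal. lia. Qed.

Lemma sum_exchange (f : nat -> nat -> R) m n :
  sum_n_m (fun i => sum_n_m (fun j => f i j) 1 n) 1 m =
  sum_n_m (fun j => sum_n_m (fun i => f i j) 1 m) 1 n.
Proof.
  induction m as [|m IH].
  - rewrite sum_empty. symmetry.
    rewrite (sum_n_m_ext _ (fun _ => 0) 1 n) by (intros; apply sum_empty).
    rewrite sum_const. apply Rmult_0_r.
  - rewrite sum_first_last, IH, <- sum_add.
    apply sum_n_m_ext; intros j. now rewrite sum_first_last.
Qed.

Lemma sum_reverse (f : nat -> R) n :
  sum_n_m (fun m => f (n - m)%nat) 1 n = sum_n_m (fun m => f (m - 1)%nat) 1 n.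
Proof.
  induction n as [|n IH].
  - now rewrite !sum_empty.
  - rewrite sum_head, sum_first_last.
    rewrite (sum_n_m_ext (fun k => f (S n - S k)%nat) (fun k => f (n - k)%nat)) by
      (intros; f_equal; lia).
    rewrite IH. replace (S n - 1)%nat with n by lia. ring_R.
Qed.

Lemma sum_append (f : nat -> R) n k :
  sum_n_m f 1 (n + k) = sum_n_m f 1 n + sum_n_m (fun i => f (n + i)%nat) 1 k.
Proof.
  induction k as [|k IH].
  - rewrite sum_empty, Nat.add_0_r; ring_R.
  - rewrite Nat.add_succ_r, !sum_first_last, IH, Nat.add_succ_r; ring_R.
Qed.

Lemma sum_periodic_shift (f : nat -> R) n s :
  (forall m, f (m + n)%nat = f m) ->
  sum_n_m (fun k => f (k + s)%nat) 1 n = sum_n_m f 1 n.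
Proof.
  intros per; induction s as [|s IH].
  - apply sum_n_m_ext; intros; f_equal; lia.
  - rewrite <- IH. destruct n as [|n]; [now rewrite !sum_empty|].
    rewrite (sum_head (fun k => f (k + s)%nat)), sum_first_last.
    replace (S n + S s)%nat with (1 + s + S n)%nat by lia. rewrite per.
    rewrite Rplus_comm; f_equal.
    apply sum_n_m_ext; intros; f_equal; lia.
Qed.

(** Negative definiteness is about singly indexed families; division with
    remainder flattens an array into one. *)
Lemma sum_div_mod (f : nat -> nat -> R) n k :
  sum_n_m (fun t => f (S ((t - 1) / k)) (S ((t - 1) mod k))) 1 (n * k) =
  sum_n_m (fun i => sum_n_m (f i) 1 k) 1 n.
Proof.
  induction n as [|n IH]; [now rewrite !sum_empty|].
  rewrite sum_first_last, <- IH.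
  replace (S n * k)%nat with (n * k + k)%nat by lia.
  rewrite sum_append; f_equal.
  apply sum_n_m_ext_loc; intros i Hi.
  replace (n * k + i - 1)%nat with ((i - 1) + n * k)%nat by lia.
  rewrite Nat.div_add, Nat.Div0.mod_add by lia.
  rewrite Nat.div_small, Nat.mod_small by lia.
  f_equal; lia.
Qed.

Lemma sum_le_longer (f : nat -> R) k l :
  (forall i, 0 <= f i) -> (k <= l)%nat -> sum_n_m f 1 k <= sum_n_m f 1 l.
Proof.
  intros f0 kl. replace l with (k + (l - k))%nat by lia. rewrite sum_append.
  assert (0 <= sum_n_m (fun i => f (k + i)%nat) 1 (l - k)); [|lra].
  rewrite <- (Rmult_0_r (INR (l - k))), <- (sum_const 0).
  apply sum_le; intros; apply f0.
Qed.

(** Every distance [|i - j|] is taken at most twice in a row. *)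
Lemma sum_row_distance_le (f : nat -> R) n i :
  (forall h, 0 <= f h) -> (1 <= i <= n)%nat ->
  sum_n_m (fun j => f ((i - j) + (j - i))%nat) 1 n <=
  2 * sum_n_m (fun h => f (h - 1)%nat) 1 n.
Proof.
  intros f0 Hi.
  replace n with (i + (n - i))%nat at 1 by lia. rewrite sum_append.
  rewrite (sum_n_m_ext_loc _ (fun j => f (i - j)%nat) 1 i)
    by (intros; f_equal; lia).
  rewrite sum_reverse.
  rewrite (sum_n_m_ext _ f 1 (n - i)) by (intros; f_equal; lia).
  pose proof (sum_le_longer (fun h => f (h - 1)%nat) i n (fun h => f0 _) ltac:(lia)).
  assert (sum_n_m f 1 (n - i) <= sum_n_m (fun h => f (h - 1)%nat) 1 n).
  { apply Rle_trans with (sum_n_m (fun h => f (h - 1)%nat) 1 (S (n - i)));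
      [|apply sum_le_longer; [auto | lia]].
    rewrite sum_head. rewrite (sum_n_m_ext (fun k => f (S k - 1)%nat) f)
      by (intros; f_equal; lia).
    pose proof (f0 (1 - 1)%nat); lra. }
  lra.
Qed.

(** * Alternating sums around a circle *)

Lemma pow_m1_add_even m k : (-1) ^ (m + 2 * k) = (-1) ^ m.
Proof. rewrite pow_add, pow_1_even; ring. Qed.

(** After the first difference, consecutive terms pair off with the right sign. *)
Lemma alternating_sum_concave (D : nat -> R) k :
  (forall m, (1 <= m)%nat -> D (S m) <= D m) ->
  - D 1%nat + D (2 * S k)%nat <= sum_n_m (fun m => (-1) ^ m * D m) 1 (2 * S k).
Proof.
  intros decr; induction k as [|k IH].
  - simpl (2 * 1)%nat. rewrite !sum_first_last, sum_empty. simpl. lra.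
  - replace (2 * S (S k))%nat with (S (S (2 * S k))) by lia.
    rewrite !sum_first_last.
    replace (S (2 * S k)) with (1 + 2 * S k)%nat at 2 3 by lia.
    replace (S (S (2 * S k))) with (2 + 2 * S k)%nat at 2 3 by lia.
    rewrite !pow_m1_add_even.
    pose proof (decr (2 * S k)%nat ltac:(lia)).
    replace (1 + 2 * S k)%nat with (S (2 * S k)) by lia.
    replace (2 + 2 * S k)%nat with (S (S (2 * S k))) by lia.
    simpl ((-1) ^ _). lra.
Qed.

(** Averaging the sum over odd second differences with the one over even second
    differences telescopes; what remains is a boundary term at the far end and
    third differences.  The symmetry [f (-1) = f 1] is what makes the boundary
    term at 0 vanish. *)
Lemma alternating_sum_third_differences (f : R -> R) (e : nat -> R) k :
  f (-1) = f 1 ->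
  (forall m, Rabs (f (INR m + 2) - 3 * f (INR m + 1) + 3 * f (INR m)
                   - f (INR m - 1)) <= e m) ->
  let D m := f (INR m) - f (INR m - 1) in
  3 * D (2 * S k)%nat - D (2 * S k - 1)%nat
    - sum_n_m (fun m => e (m - 1)%nat) 1 (2 * S k - 1)
  <= 4 * sum_n_m (fun m => (-1) ^ m * D m) 1 (2 * S k).
Proof.
  intros even bound D; induction k as [|k IH].
  - simpl (2 * 1)%nat. simpl (2 - 1)%nat.
    rewrite !sum_first_last, !sum_empty. simpl (1 - 1)%nat.
    specialize (bound 0%nat). apply Rabs_le_between in bound.
    unfold D. simpl in *. replace (0 - 1) with (-1) in bound by ring.
    rewrite even in bound.
    replace (0 + 2) with (1 + 1) in bound by ring.
    replace (0 + 1) with 1 in bound by ring.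
    replace (1 + 1 - 1) with 1 by ring. replace (1 - 1) with 0 by ring. lra.
  - set (n := (2 * S k)%nat) in *.
    replace (2 * S (S k))%nat with (S (S n)) by (unfold n; lia).
    rewrite !sum_first_last.
    assert (En : (-1) ^ n = 1) by apply pow_1_even.
    rewrite <- !tech_pow_Rmult, En.
    replace (S (S n) - 1)%nat with (S (S (n - 1))) by (unfold n; lia).
    rewrite !sum_first_last.
    replace (S (n - 1) - 1)%nat with (n - 1)%nat by lia.
    replace (S (S (n - 1)) - 1)%nat with n by (unfold n; lia).
    replace (S (S (n - 1))) with (S n) by (unfold n; lia).
    pose proof (bound (n - 1)%nat) as B1. pose proof (bound n) as B2.
    apply Rabs_le_between in B1. apply Rabs_le_between in B2.
    assert (EI : INR (n - 1) = INR n - 1)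
      by (rewrite minus_INR by (unfold n; lia); reflexivity).
    unfold D in *. rewrite !S_INR in *. rewrite EI in *.
    replace (INR n - 1 + 2) with (INR n + 1) in * by ring.
    replace (INR n - 1 + 1) with (INR n) in * by ring.
    replace (INR n + 1 + 1 - 1) with (INR n + 1) in * by ring.
    replace (INR n + 1 + 1) with (INR n + 2) in * by ring.
    replace (INR n + 1 - 1) with (INR n) in * by ring.
    lra.
Qed.

(** Number of steps on the shorter arc from 0 to [m] among [2 n] points placed
    around a circle. *)
Definition circle_dist (n m : nat) : nat :=
  Nat.min (m mod (2 * n)) (2 * n - m mod (2 * n)).

Lemma circle_dist_periodic n m : circle_dist n (m + 2 * n) = circle_dist n m.
Proof.
  unfold circle_dist.
  replace (m + 2 * n)%nat with (m + 1 * (2 * n))%nat by lia.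
  now rewrite Nat.Div0.mod_add.
Qed.

(** Folding the circle at the point opposite to 0. *)
Lemma sum_around_circle (f : nat -> R) n :
  sum_n_m (fun m => (-1) ^ m * f (circle_dist n m)) 1 (2 * n) =
  sum_n_m (fun m => (-1) ^ m * (f m - f (m - 1)%nat)) 1 n.
Proof.
  replace (2 * n)%nat with (n + n)%nat by lia. rewrite sum_append.
  rewrite (sum_n_m_ext_loc _ (fun m => (-1) ^ m * f m) 1 n).
  2:{ intros m Hm. unfold circle_dist. rewrite Nat.mod_small by lia.
      do 2 f_equal; lia. }
  rewrite (sum_n_m_ext_loc
    (fun m => (-1) ^ (n + m) * f (circle_dist n (n + m)))
    (fun m => (-1) ^ (n - m)%nat * f (n - m)%nat) 1 n).
  2:{ intros m Hm. f_equal.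
      - rewrite <- (pow_m1_add_even (n - m) m). f_equal; lia.
      - f_equal. unfold circle_dist. destruct (Nat.eq_dec m n) as [->|ne].
        + replace (n + n)%nat with (2 * n)%nat by lia.
          rewrite Nat.Div0.mod_same; lia.
        + rewrite Nat.mod_small; lia. }
  rewrite (sum_reverse (fun m => (-1) ^ m * f m)), <- sum_add.
  apply sum_n_m_ext_loc; intros m Hm.
  destruct m as [|m]; [lia|].
  replace (S m - 1)%nat with m by lia. rewrite <- tech_pow_Rmult. ring_R.
Qed.

(** By rotational symmetry every point of the circle sees the same sum. *)
Lemma sum_circle_pairs (f : nat -> R) n :
  sum_n_m (fun k => sum_n_m (fun l =>
    (-1) ^ k * (-1) ^ l * f (circle_dist n (l + (2 * n - k)))) 1 (2 * n)) 1 (2 * n) =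
  INR (2 * n) * sum_n_m (fun m => (-1) ^ m * (f m - f (m - 1)%nat)) 1 n.
Proof.
  rewrite <- sum_const. apply sum_n_m_ext_loc; intros k Hk.
  rewrite <- sum_around_circle.
  rewrite <- (sum_periodic_shift
    (fun m => (-1) ^ m * f (circle_dist n m)) (2 * n) (2 * n - k)).
  - apply sum_n_m_ext; intros l. cbv beta. rewrite <- pow_add. f_equal.
    rewrite <- (pow_m1_add_even (l + (2 * n - k)) k).
    rewrite <- (pow_m1_add_even (k + l) n). f_equal; lia.
  - intros m. now rewrite pow_m1_add_even, circle_dist_periodic.
Qed.

(** * Powers *)

Lemma Rpower_pos x a : 0 < Rpower x a.
Proof. apply exp_pos. Qed.

Lemma nonneg_power_pos x a : 0 < x -> nonneg_power x a = Rpower x a.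
Proof. intros; unfold nonneg_power; destruct (Req_EM_T x 0); lra. Qed.

Lemma nonneg_power_0 a : nonneg_power 0 a = 0.
Proof. unfold nonneg_power; destruct (Req_EM_T 0 0); lra. Qed.

Lemma nonneg_power_mult x y a :
  0 < x -> 0 <= y -> nonneg_power (x * y) a = Rpower x a * nonneg_power y a.
Proof.
  intros Hx [Hy|<-].
  - rewrite !nonneg_power_pos by nra. symmetry; now apply Rpower_mult_distr.
  - rewrite Rmult_0_r, nonneg_power_0; ring.
Qed.

Lemma Rpower_le_nonpos x y a :
  0 < x -> x <= y -> a <= 0 -> Rpower y a <= Rpower x a.
Proof.
  intros Hx [Hxy|<-] Ha; [|lra].
  unfold Rpower.
  assert (ln x <= ln y) by (left; now apply ln_increasing).
  assert (E : a * ln y <= a * ln x) by nra.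
  destruct E as [E| ->]; [left; now apply exp_increasing|lra].
Qed.

(** Bernoulli's inequality for exponents between 0 and 1, from the convexity
    of [exp]. *)
Lemma nonneg_power_bernoulli x a :
  0 <= x -> 0 < a <= 1 -> nonneg_power x a <= 1 + a * (x - 1).
Proof.
  intros [Hx|<-] Ha.
  2:{ rewrite nonneg_power_0; lra. }
  rewrite nonneg_power_pos by assumption. unfold Rpower.
  set (t := ln x). replace x with (exp t) by (apply exp_ln; assumption).
  assert (E1 : exp t = exp (a * t) * exp (t - a * t)) by
    (rewrite <- exp_plus; f_equal; ring).
  assert (E2 : 1 = exp (a * t) * exp (- (a * t))) by
    (rewrite <- exp_plus, <- exp_0; f_equal; ring).
  pose proof (exp_ineq1_le (t - a * t)). pose proof (exp_ineq1_le (- (a * t))).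
  pose proof (exp_pos (a * t)).
  assert (1 <= a * exp (t - a * t) + (1 - a) * exp (- (a * t))) by nra.
  apply Rle_trans with (exp (a * t) * (a * exp (t - a * t) + (1 - a) * exp (- (a * t)))).
  - rewrite <- (Rmult_1_r (exp (a * t))) at 1. apply Rmult_le_compat_l; lra.
  - rewrite Rmult_plus_distr_l, <- Rmult_assoc, (Rmult_comm (exp (a * t)) a).
    rewrite Rmult_assoc, <- E1.
    replace (exp (a * t) * ((1 - a) * exp (- (a * t))))
      with ((1 - a) * (exp (a * t) * exp (- (a * t)))) by ring.
    rewrite <- E2. lra.
Qed.

(** * Harmonic sums *)

Definition harmonic (n : nat) : R := sum_n_m (fun k => / INR k) 1 n.

Lemma harmonic_ge_1 n : (1 <= n)%nat -> 1 <= harmonic n.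
Proof.
  intros Hn; unfold harmonic. destruct n as [|n]; [lia|].
  rewrite sum_head. simpl (INR 1).
  assert (0 <= sum_n_m (fun k => / INR (S k)) 1 n).
  { rewrite <- (Rmult_0_r (INR n)), <- (sum_const 0). apply sum_le; intros.
    left; apply Rinv_0_lt_compat, lt_0_INR; lia. }
  lra.
Qed.

Lemma harmonic_le_ln n : (1 <= n)%nat -> harmonic n <= 1 + ln (INR n).
Proof.
  unfold harmonic; induction n as [|n IH]; [lia|]. intros _.
  destruct n as [|n].
  - rewrite sum_first_last, sum_empty. simpl. rewrite ln_1, Rinv_1; lra.
  - rewrite sum_first_last.
    specialize (IH ltac:(lia)).
    set (x := INR (S n)) in *.
    assert (Hx : 0 < x) by (apply lt_0_INR; lia).
    rewrite (S_INR (S n)); fold x.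
    assert (ln x - ln (x + 1) <= - / (x + 1)); [|lra].
    rewrite <- ln_div by lra.
    assert (0 < x / (x + 1)) by (apply Rdiv_lt_0_compat; lra).
    pose proof (exp_ineq1_le (ln (x / (x + 1)))) as E.
    rewrite exp_ln in E by assumption.
    replace (x / (x + 1)) with (1 - / (x + 1)) in E at 2 by (field; lra). lra.
Qed.

Lemma harmonic_le_power n b :
  (1 <= n)%nat -> 0 < b <= 1 -> harmonic n <= / b * Rpower (INR n) b.
Proof.
  intros Hn Hb. apply Rle_trans with (1 + ln (INR n)); [now apply harmonic_le_ln|].
  assert (0 <= ln (INR n)).
  { rewrite <- ln_1. apply ln_le; [lra|]. change 1 with (INR 1). now apply le_INR. }
  pose proof (exp_ineq1_le (b * ln (INR n))) as E. fold (Rpower (INR n) b) in E.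
  apply Rmult_le_reg_l with b; [lra|].
  rewrite <- Rmult_assoc, Rinv_r by lra. nra.
Qed.

(** * Differences of powers of the distance on a square lattice *)

(** [d^a] for two points of the square lattice whose difference is [(x, h)]. *)
Definition lattice_power (a h x : R) : R := nonneg_power (sqrt (x ^ 2 + h ^ 2)) a.

Lemma lattice_power_smooth a h x :
  0 < h -> lattice_power a h x = Rpower (x ^ 2 + h ^ 2) (a / 2).
Proof.
  intros Hh. unfold lattice_power.
  assert (0 < x ^ 2 + h ^ 2) by nra.
  rewrite nonneg_power_pos by now apply sqrt_lt_R0.
  rewrite <- Rpower_sqrt, Rpower_mult by assumption. f_equal; field.
Qed.

Lemma lattice_power_axis a x : 0 <= x -> lattice_power a 0 x = nonneg_power x a.
Proof.
  intros; unfold lattice_power. rewrite pow_i, Rplus_0_r, sqrt_pow2 by (lia || lra).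
  reflexivity.
Qed.

Lemma lattice_power_axis_concave a m :
  0 < a <= 1 -> (1 <= m)%nat ->
  lattice_power a 0 (INR m + 1) - lattice_power a 0 (INR m) <=
  lattice_power a 0 (INR m) - lattice_power a 0 (INR m - 1).
Proof.
  intros Ha Hm. set (x := INR m).
  assert (Hx : 1 <= x) by (change 1 with (INR 1); now apply le_INR).
  rewrite !lattice_power_axis by lra.
  replace (x + 1) with (x * (1 + / x)) by (field; lra).
  replace (x - 1) with (x * (1 - / x)) by (field; lra).
  assert (0 < / x) by (apply Rinv_0_lt_compat; lra).
  assert (/ x <= 1) by (rewrite <- Rinv_1; apply Rinv_le_contravar; lra).
  rewrite !nonneg_power_mult, (nonneg_power_pos x) by lra.
  pose proof (nonneg_power_bernoulli (1 + / x) a ltac:(lra) Ha).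
  pose proof (nonneg_power_bernoulli (1 - / x) a ltac:(lra) Ha).
  pose proof (Rpower_pos x a).
  assert (nonneg_power (1 + / x) a + nonneg_power (1 - / x) a <= 2) by lra.
  nra.
Qed.

Lemma is_derive_continuity_pt (f : R -> R) x l :
  is_derive f x l -> continuity_pt f x.
Proof.
  intros H. apply derivable_continuous_pt. exists l. now apply is_derive_Reals.
Qed.

Lemma difference_bound (f f' : R -> R) y K :
  (forall x, is_derive f x (f' x)) ->
  (forall x, y <= x <= y + 1 -> Rabs (f' x) <= K) ->
  Rabs (f (y + 1) - f y) <= K.
Proof.
  intros Hf HK.
  destruct (MVT_gen f y (y + 1) f') as [c [Hc E]].
  - intros; apply Hf.
  - intros x _. eapply is_derive_continuity_pt; apply Hf.
  - rewrite Rmin_left, Rmax_right in Hc by lra.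
    rewrite E. replace (f' c * (y + 1 - y)) with (f' c) by ring. now apply HK.
Qed.

(** The mean value inequality, three times. *)
Lemma third_difference_bound (f f1 f2 f3 : R -> R) y K :
  (forall x, is_derive f x (f1 x)) ->
  (forall x, is_derive f1 x (f2 x)) ->
  (forall x, is_derive f2 x (f3 x)) ->
  (forall x, y - 1 <= x <= y + 2 -> Rabs (f3 x) <= K) ->
  Rabs (f (y + 2) - 3 * f (y + 1) + 3 * f y - f (y - 1)) <= K.
Proof.
  intros H1 H2 H3 HK.
  assert (shift : forall g g' : R -> R, (forall x, is_derive g x (g' x)) ->
            forall s x, is_derive (fun t => g (t + s)) x (g' (x + s))).
  { intros g g' Hg s x. auto_derive; [eexists; apply Hg|].
    rewrite Rmult_1_l. now apply is_derive_unique. }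
  assert (sub : forall g g' k k' : R -> R, (forall x, is_derive g x (g' x)) ->
            (forall x, is_derive k x (k' x)) ->
            forall x, is_derive (fun t => g t - k t) x (g' x - k' x)).
  { intros g g' k k' Hg Hk x. now apply (is_derive_minus g k). }
  set (d := fun g : R -> R => fun t => g (t + 1) - g t).
  assert (dd : forall g g', (forall x, is_derive g x (g' x)) ->
             forall x, is_derive (d g) x (d g' x)).
  { intros g g' Hg. apply sub; [apply shift|]; auto. }
  replace (f (y + 2) - 3 * f (y + 1) + 3 * f y - f (y - 1))
    with (d (d f) (y - 1 + 1) - d (d f) (y - 1)).
  2:{ unfold d. replace (y - 1 + 1 + 1 + 1) with (y + 2) by ring.
      replace (y - 1 + 1 + 1) with (y + 1) by ring.
      replace (y - 1 + 1) with y by ring. ring. }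
  apply difference_bound with (d (d f1)); [auto|]. intros x Hx.
  apply (difference_bound (d f1) (d f2)); [auto|]. intros x' Hx'.
  apply (difference_bound f2 f3); [auto|]. intros x'' Hx''. apply HK; lra.
Qed.

Section Lattice_power.

Variables (a h : R).
Hypothesis (Ha : 0 < a <= 1) (Hh : 1 <= h).

Let u (x : R) := x ^ 2 + h ^ 2.

Lemma radius_power_derivative b x :
  is_derive (fun t => Rpower (u t) b) x (2 * b * x * Rpower (u x) (b - 1)).
Proof.
  unfold u, Rpower. assert (0 < x ^ 2 + h ^ 2) by nra.
  auto_derive; [lra|].
  replace ((b - 1) * ln (x ^ 2 + h ^ 2))
    with (b * ln (x ^ 2 + h ^ 2) + - ln (x ^ 2 + h ^ 2)) by ring.
  rewrite exp_plus, exp_Ropp, exp_ln by assumption.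
  replace (x * (x * 1) + h * (h * 1)) with (x ^ 2 + h ^ 2) by ring.
  field. lra.
Qed.

Let g x := Rpower (u x) (a / 2).
Let g1 x := a * x * Rpower (u x) (a / 2 - 1).
Let g2 x := a * Rpower (u x) (a / 2 - 1)
            + a * (a - 2) * x ^ 2 * Rpower (u x) (a / 2 - 1 - 1).
Let g3 x := a * (a - 2) * x * Rpower (u x) (a / 2 - 1 - 1 - 1)
            * (3 * u x + (a - 4) * x ^ 2).

Lemma radius_power_pred x b : Rpower (u x) b = u x * Rpower (u x) (b - 1).
Proof.
  assert (0 < u x) by (unfold u; nra).
  rewrite <- (Rpower_1 (u x)) at 2 by assumption.
  rewrite <- Rpower_plus. f_equal; ring.
Qed.

Lemma lattice_power_derivative_1 x : is_derive g x (g1 x).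
Proof.
  unfold g, g1. replace (a * x) with (2 * (a / 2) * x) by field.
  apply radius_power_derivative.
Qed.

Lemma lattice_power_derivative_2 x : is_derive g1 x (g2 x).
Proof.
  pose (w := fun t => Rpower (u t) (a / 2 - 1)).
  assert (E : is_derive w x _) by apply radius_power_derivative.
  change (is_derive (fun t => a * t * w t) x
    (a * w x + a * (a - 2) * x ^ 2 * Rpower (u x) (a / 2 - 1 - 1))).
  clearbody w. auto_derive; [eexists; exact E|].
  assert (E1 : Derive (fun t : R => w t) x = _) by (apply is_derive_unique, E).
  rewrite E1. field.
Qed.

Lemma lattice_power_derivative_3 x : is_derive g2 x (g3 x).
Proof.
  unfold g3.
  pose (w := fun t => Rpower (u t) (a / 2 - 1)).
  pose (w' := fun t => Rpower (u t) (a / 2 - 1 - 1)).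
  assert (E : is_derive w x _) by apply radius_power_derivative.
  assert (E' : is_derive w' x _) by apply radius_power_derivative.
  rewrite (radius_power_pred x (a / 2 - 1 - 1)) in E.
  change (is_derive (fun t => a * w t + a * (a - 2) * t ^ 2 * w' t) x
    (a * (a - 2) * x * Rpower (u x) (a / 2 - 1 - 1 - 1)
            * (3 * u x + (a - 4) * x ^ 2))).
  assert (Ew : w' x = u x * Rpower (u x) (a / 2 - 1 - 1 - 1)) by apply radius_power_pred.
  clearbody w w'.
  auto_derive; [split; [eexists; exact E|split; [eexists; exact E'|trivial]]|].
  assert (E1 : Derive (fun t : R => w t) x = _) by (apply is_derive_unique, E).
  assert (E2 : Derive (fun t : R => w' t) x = _) by (apply is_derive_unique, E').
  rewrite E1, E2, Ew. field.
Qed.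

(** The third derivative is of order [u^((a-3)/2)], and [a <= 1 <= u]. *)
Lemma lattice_power_third_derivative_bound x : Rabs (g3 x) <= 6 / u x.
Proof.
  assert (Hu : 1 <= u x) by (unfold u; nra).
  assert (Hxu : Rabs x <= Rpower (u x) (/ 2)).
  { rewrite Rpower_sqrt by lra. rewrite <- (sqrt_pow2 (Rabs x)) by apply Rabs_pos.
    apply sqrt_le_1_alt. rewrite pow2_abs. unfold u; nra. }
  assert (Hw : Rabs (3 * u x + (a - 4) * x ^ 2) <= 3 * u x).
  { apply Rabs_le. assert (0 <= x ^ 2 <= u x) by (unfold u; nra). split; nra. }
  assert (Hc : Rabs (a * (a - 2)) <= 2) by (apply Rabs_le; nra).
  unfold g3. rewrite !Rabs_mult, (Rabs_right (Rpower _ _)) by (left; apply Rpower_pos).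
  apply Rle_trans with
    (2 * Rpower (u x) (/ 2) * Rpower (u x) (a / 2 - 1 - 1 - 1) * (3 * u x)).
  { rewrite <- Rabs_mult.
    repeat (apply Rmult_le_compat; try assumption;
            repeat apply Rmult_le_pos; try apply Rabs_pos; try lra;
            try (left; apply Rpower_pos)). }
  replace (2 * Rpower (u x) (/ 2) * Rpower (u x) (a / 2 - 1 - 1 - 1) * (3 * u x))
    with (6 * (Rpower (u x) (/ 2) * Rpower (u x) (a / 2 - 1 - 1 - 1)
               * Rpower (u x) 1)) by (rewrite Rpower_1 by lra; ring).
  rewrite <- !Rpower_plus. apply Rmult_le_compat_l; [lra|].
  rewrite <- (Rpower_1 (u x)) at 2 by lra. rewrite <- Rpower_Ropp.
  apply Rle_Rpower; lra.
Qed.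

(** [x^2 + h^2] dominates [(m + 1) h] near [m]: in this form the bound separates
    the variables, so that its double sum is a product of harmonic sums. *)
Lemma lattice_power_third_difference m :
  Rabs (lattice_power a h (INR m + 2) - 3 * lattice_power a h (INR m + 1)
        + 3 * lattice_power a h (INR m) - lattice_power a h (INR m - 1))
  <= 27 / h * / INR (S m).
Proof.
  rewrite !lattice_power_smooth by lra.
  apply (third_difference_bound g g1 g2 g3);
    auto using lattice_power_derivative_1, lattice_power_derivative_2, lattice_power_derivative_3.
  intros x Hx. eapply Rle_trans; [apply lattice_power_third_derivative_bound|].
  rewrite S_INR. pose proof (pos_INR m).
  assert (0 < (INR m + 1) * h) by nra.
  replace (27 / h * / (INR m + 1)) with (6 / (2 / 9 * ((INR m + 1) * h)))
    by (field; nra).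
  apply Rmult_le_compat_l; [lra|]. apply Rinv_le_contravar; [lra|].
  (* (m + 1)^2 <= (x + 2)^2 <= 2 x^2 + 8 h^2 *)
  unfold u.
  assert ((INR m + 1) ^ 2 <= (x + 2) ^ 2) by (apply pow_incr; lra).
  assert (0 <= (x - 2) ^ 2) by apply pow2_ge_0.
  assert (0 <= (INR m + 1 - h) ^ 2) by apply pow2_ge_0.
  nra.
Qed.

(** The boundary term left by [alternating_sum_third_differences].  As [h <= n],
    the slope is comparable to [n^(a-1)] on [n-2, n] and varies there by a factor 2
    at most. *)
Lemma lattice_power_end_slope n :
  8 <= n -> h <= n ->
  a / 4 * Rpower n (a - 1) <=
  3 * (lattice_power a h n - lattice_power a h (n - 1))
  - (lattice_power a h (n - 1) - lattice_power a h (n - 1 - 1)).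
Proof.
  intros Hn Hhn. rewrite !lattice_power_smooth by lra.
  fold (u n) (u (n - 1)) (u (n - 1 - 1)).
  fold (g n) (g (n - 1)) (g (n - 1 - 1)).
  assert (MVT : forall y, exists c, y - 1 <= c <= y /\ g y - g (y - 1) = g1 c).
  { intros y. destruct (MVT_gen g (y - 1) y g1) as [c [Hc E]].
    - intros; apply lattice_power_derivative_1.
    - intros x _. eapply is_derive_continuity_pt; apply lattice_power_derivative_1.
    - rewrite Rmin_left, Rmax_right in Hc by lra. exists c; split; [assumption|].
      rewrite E; ring. }
  destruct (MVT n) as [y [Hy ->]]. destruct (MVT (n - 1)) as [x [Hx ->]].
  assert (Hux : 0 < u x) by (unfold u; nra).
  assert (Huy : 0 < u y) by (unfold u; nra).
  assert (Hxy : g1 x <= 2 * g1 y).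
  { unfold g1.
    assert (Rpower (u x) (a / 2 - 1) <= 2 * Rpower (u y) (a / 2 - 1)).
    { assert (u y <= 2 * u x) by (unfold u; nra).
      apply Rle_trans with (Rpower (u y / 2) (a / 2 - 1)).
      - apply Rpower_le_nonpos; lra.
      - unfold Rdiv at 1. rewrite <- Rpower_mult_distr by lra.
        rewrite Rmult_comm. apply Rmult_le_compat_r; [left; apply Rpower_pos|].
        set (b := a / 2 - 1). assert (-1 <= b) by (unfold b; lra).
        replace (Rpower (/ 2) b) with (Rpower 2 (- b)).
        + apply Rle_trans with (Rpower 2 1); [|rewrite Rpower_1; lra].
          apply Rle_Rpower; lra.
        + unfold Rpower. rewrite ln_Rinv by lra. f_equal; ring. }
    pose proof (Rpower_pos (u x) (a / 2 - 1)).
    pose proof (Rpower_pos (u y) (a / 2 - 1)).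
    apply Rle_trans with (a * y * Rpower (u x) (a / 2 - 1)).
    - apply Rmult_le_compat_r; [lra|]. apply Rmult_le_compat_l; lra.
    - assert (0 < a * y) by nra. nra. }
  assert (a / 4 * Rpower n (a - 1) <= g1 y); [|lra].
  unfold g1.
  (* [y >= n / 2] and [u y <= 2 n^2] *)
  apply Rle_trans with (a * (n / 2) * Rpower (2 * n ^ 2) (a / 2 - 1)).
  - rewrite <- Rpower_mult_distr by nra.
    rewrite <- Rpower_pow, Rpower_mult by lra.
    replace (INR 2 * (a / 2 - 1)) with (a - 1 + - (1)) by (simpl; field).
    rewrite Rpower_plus, Rpower_Ropp, Rpower_1 by lra.
    assert (/ 2 <= Rpower 2 (a / 2 - 1)).
    { apply Rle_trans with (Rpower 2 (- (1))).
      - rewrite Rpower_Ropp, Rpower_1; lra.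
      - apply Rle_Rpower; lra. }
    replace (a * (n / 2) * (Rpower 2 (a / 2 - 1) * (Rpower n (a - 1) * / n)))
      with (a / 2 * Rpower n (a - 1) * Rpower 2 (a / 2 - 1)) by (field; lra).
    pose proof (Rpower_pos n (a - 1)).
    replace (a / 4 * Rpower n (a - 1)) with (a / 2 * Rpower n (a - 1) * / 2) by field.
    apply Rmult_le_compat_l; [nra|assumption].
  - apply Rmult_le_compat; [nra|left; apply Rpower_pos|nra|].
    apply Rpower_le_nonpos; [assumption|unfold u; nra|lra].
Qed.

End Lattice_power.

Lemma lattice_power_even a h x : lattice_power a h (- x) = lattice_power a h x.
Proof. unfold lattice_power. do 2 f_equal. ring. Qed.

(** The contribution of two levels at distance [h].  For [h > 0] the main term is
    the kink of the distance at the opposite point of the circle; it is positive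
    because [n] is even.  For [h = 0] the negative contribution [-1] of the
    singularity of [x^a] at 0 dominates, and is covered by the loss. *)
Lemma alternating_lattice_power a h k :
  0 < a <= 1 -> (4 <= k)%nat -> (h <= 2 * k)%nat ->
  let n := (2 * k)%nat in
  a / 16 * Rpower (INR n) (a - 1) - 14 * harmonic n / INR (S h) <=
  sum_n_m (fun m => (-1) ^ m *
    (lattice_power a (INR h) (INR m) - lattice_power a (INR h) (INR (m - 1)))) 1 n.
Proof.
  intros Ha Hk Hh n.
  assert (Hn : 8 <= INR n).
  { replace 8 with (INR 8) by (simpl; ring). apply le_INR; unfold n; lia. }
  assert (HH : 1 <= harmonic n) by (apply harmonic_ge_1; unfold n; lia).
  rewrite (sum_n_m_ext_loc _ (fun m => (-1) ^ m *
    (lattice_power a (INR h) (INR m) - lattice_power a (INR h) (INR m - 1)))).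
  2:{ intros m Hm. rewrite minus_INR by lia. reflexivity. }
  destruct k as [|k]; [lia|]. destruct h as [|h].
  - simpl (INR 0).
    assert (S0 := alternating_sum_concave
      (fun m => lattice_power a 0 (INR m) - lattice_power a 0 (INR m - 1)) k).
    cbv beta in S0. fold n in S0.
    assert (Rpower (INR n) (a - 1) <= 1).
    { apply Rle_trans with (Rpower (INR n) 0); [apply Rle_Rpower; lra|].
      rewrite Rpower_O; lra. }
    assert (lattice_power a 0 (INR n - 1) <= lattice_power a 0 (INR n)).
    { rewrite !lattice_power_axis, !nonneg_power_pos by lra.
      apply Rle_Rpower_l; lra. }
    assert (lattice_power a 0 (INR 1) = 1).
    { simpl. rewrite lattice_power_axis, nonneg_power_pos by lra.
      unfold Rpower. rewrite ln_1, Rmult_0_r. apply exp_0. }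
    assert (lattice_power a 0 (INR 1 - 1) = 0).
    { simpl. rewrite lattice_power_axis by lra.
      rewrite Rminus_diag. apply nonneg_power_0. }
    simpl (INR 1) in *.
    unfold Rdiv at 2. rewrite Rinv_1.
    assert (a / 16 * Rpower (INR n) (a - 1) <= 1 * 1)
      by (apply Rmult_le_compat; try lra; left; apply Rpower_pos).
    eapply Rle_trans; [|apply S0].
    + lra.
    + intros m Hm. rewrite !S_INR. replace (INR m + 1 - 1) with (INR m) by ring.
      now apply lattice_power_axis_concave.
  - set (x := INR (S h)).
    assert (Hx : 1 <= x) by (change 1 with (INR 1); apply le_INR; lia).
    assert (Hxn : x <= INR n) by (apply le_INR; exact Hh).
    assert (S1 := alternating_sum_third_differences (lattice_power a x)
              (fun m => 27 / x * / INR (S m)) k (lattice_power_even a x 1)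
              (lattice_power_third_difference a x Ha Hx)).
    cbv beta zeta in S1. fold n in S1.
    pose proof (lattice_power_end_slope a x Ha Hx (INR n) Hn Hxn) as E.
    assert (EI : INR (n - 1) = INR n - 1)
      by (rewrite minus_INR by (unfold n; lia); reflexivity).
    rewrite EI in S1.
    assert (L : sum_n_m (fun m => 27 / x * / INR (S (m - 1))) 1 (n - 1)
                <= 27 / x * harmonic n).
    { rewrite sum_mult_l. apply Rmult_le_compat_l.
      - apply Rlt_le, Rdiv_lt_0_compat; lra.
      - unfold harmonic. replace n with (S (n - 1)) at 2 by (unfold n; lia).
        rewrite sum_first_last.
        assert (0 < / INR (S (n - 1))) by (apply Rinv_0_lt_compat, lt_0_INR; lia).
        rewrite (sum_n_m_ext_loc (fun m => / INR (S (m - 1))) (fun m => / INR m))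
          by (intros; do 2 f_equal; lia).
        lra. }
    rewrite (S_INR (S h)). fold x.
    assert (27 / x * harmonic n <= 4 * (14 * harmonic n / (x + 1))).
    { apply Rmult_le_reg_r with (x * (x + 1)); [nra|].
      replace (27 / x * harmonic n * (x * (x + 1)))
        with (27 * (x + 1) * harmonic n) by (field; lra).
      replace (4 * (14 * harmonic n / (x + 1)) * (x * (x + 1)))
        with (56 * x * harmonic n) by (field; lra).
      assert (0 <= (29 * x - 27) * harmonic n) by (apply Rmult_le_pos; lra). lra. }
    lra.
Qed.

(** * Functions of class C^1 on an interval *)

Lemma C1_on_of_is_derive (D : R -> Prop) (f f' : R -> R) :
  (forall x, is_derive f x (f' x)) -> (forall x, continuous f' x) -> C1_on D f f'.
Proof.
  intros Hf Hc; split.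
  - intros x _ eps Heps. specialize (Hf x). apply is_derive_Reals in Hf.
    destruct (Hf eps Heps) as [d Hd]. exists d; split; [apply cond_pos|].
    intros y [[_ Hne] Hy]. simpl in *. unfold R_dist in *.
    replace (f y) with (f (x + (y - x))) by (f_equal; ring).
    apply Hd; [lra|assumption].
  - intros x _. intros P HP.
    specialize (Hc x P HP). unfold filtermap, within in *.
    revert Hc. apply filter_imp; auto.
Qed.

(** The derivative composed with a retraction onto the interval has a primitive
    on the whole line, so that the one-sided derivatives at the ends disappear. *)
Lemma C1_extension (D : R -> Prop) (rho f f' : R -> R) x0 :
  (forall x, D (rho x)) -> (forall x, D x -> rho x = x) ->
  (forall x y, Rabs (rho x - rho y) <= Rabs (x - y)) ->
  (forall x y t, D x -> D y -> x <= t <= y -> D t) ->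
  D x0 -> C1_on D f f' ->
  exists F, (forall x, is_derive F x (f' (rho x))) /\
            (forall x, continuous (fun t => f' (rho t)) x) /\
            (forall x, D x -> F x = f x).
Proof.
  intros Drho rho_id rho_lip conv Dx0 [Hd Hc].
  assert (cont : forall x, continuous (fun t => f' (rho t)) x).
  { intros x. apply filterlim_locally. intros eps.
    assert (H := Hc (rho x) (Drho x)).
    apply (proj1 (filterlim_locally _ _)) with (eps := eps) in H.
    destruct H as [d H]. exists d. intros y Hy. apply H; [|apply Drho].
    change (Rabs (rho y - rho x) < d). change (Rabs (y - x) < d) in Hy.
    specialize (rho_lip y x). lra. }
  exists (fun x => f x0 + RInt (fun t => f' (rho t)) x0 x).
  assert (der : forall x, is_derive (fun x => f x0 + RInt (fun t => f' (rho t)) x0 x)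
                            x (f' (rho x))).
  { intros x. rewrite <- (Rplus_0_l (f' (rho x))).
    apply (is_derive_plus (fun _ => f x0)); [apply is_derive_Reals, derivable_pt_lim_const|].
    apply (is_derive_RInt (fun t => f' (rho t)) (RInt (fun t => f' (rho t)) x0) x0 x);
      [|apply cont].
    exists (mkposreal 1 Rlt_0_1). intros y _. apply (RInt_correct (fun t => f' (rho t))).
    apply (ex_RInt_continuous (fun t => f' (rho t))); auto. }
  split; [exact der|split; [exact cont|]].
  intros x Dx.
  set (F := fun x => f x0 + RInt (fun t => f' (rho t)) x0 x) in *.
  (* at the ends of [D] only [f] composed with [rho] is continuous on both sides *)
  destruct (MVT_gen (fun t => f (rho t) - F t) x0 x (fun _ => 0)) as [c [_ E]].
  - intros t Ht.
    assert (Dt : D t).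
    { unfold Rmin, Rmax in Ht. destruct (Rle_dec x0 x).
      - apply (conv x0 x); auto; lra.
      - apply (conv x x0); auto; lra. }
    assert (Dnear : forall y, Rabs (y - t) < Rmin (t - Rmin x0 x) (Rmax x0 x - t) -> D y).
    { intros y Hy. apply Rabs_lt_between in Hy.
      assert (Rmin x0 x <= y <= Rmax x0 x).
      { pose proof (Rmin_l (t - Rmin x0 x) (Rmax x0 x - t)).
        pose proof (Rmin_r (t - Rmin x0 x) (Rmax x0 x - t)). lra. }
      revert H. unfold Rmin, Rmax. destruct (Rle_dec x0 x); intros H.
      - apply (conv x0 x); auto; lra.
      - apply (conv x x0); auto; lra. }
    replace 0 with (f' t - f' (rho t)) by (rewrite rho_id by assumption; ring).
    apply (is_derive_minus (fun t => f (rho t)) F); [|apply der].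
    apply is_derive_Reals. intros eps Heps.
    destruct (Hd t Dt eps Heps) as [d [Hd0 Hd1]].
    assert (Hm : 0 < Rmin d (Rmin (t - Rmin x0 x) (Rmax x0 x - t)))
      by (repeat apply Rmin_pos; lra).
    exists (mkposreal _ Hm). intros h Hh0 Hh. simpl in Hh.
    assert (Dh : D (t + h)).
    { apply Dnear. replace (t + h - t) with h by ring.
      eapply Rlt_le_trans; [exact Hh|apply Rmin_r]. }
    rewrite !rho_id by assumption.
    specialize (Hd1 (t + h)). simpl in Hd1. unfold R_dist in Hd1.
    replace (t + h - t) with h in Hd1 by ring. apply Hd1.
    split; [split; [assumption|lra]|].
    eapply Rlt_le_trans; [exact Hh|apply Rmin_l].
  - intros t _. apply continuity_pt_minus.
    + intros eps Heps.
      destruct (cont_deriv f f' D (rho t) (Hd _ (Drho t)) eps Heps) as [d [Hd0 Hd1]].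
      exists d; split; [assumption|]. intros y [[_ Hne] Hy].
      simpl in *. unfold R_dist in *.
      destruct (Req_dec (rho y) (rho t)) as [->|ne].
      * rewrite Rminus_diag, Rabs_R0; assumption.
      * apply Hd1. split; [split; [apply Drho|auto]|].
        specialize (rho_lip y t). lra.
    + eapply is_derive_continuity_pt; apply der.
  - rewrite !rho_id in E by assumption.
    assert (E0 : F x0 = f x0).
    { unfold F. rewrite RInt_point. apply Rplus_0_r. }
    change (@eq R (F x) (f x)). lra.
Qed.

Definition clamp (t : R) : R := Rmax 0 (Rmin t 1).

Lemma clamp_unit t : unit_interval (clamp t).
Proof.
  unfold clamp, unit_interval, Rmax, Rmin.
  destruct (Rle_dec t 1); destruct (Rle_dec 0 _); lra.
Qed.

Lemma clamp_id t : unit_interval t -> clamp t = t.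
Proof.
  unfold clamp, unit_interval, Rmax, Rmin; intros.
  destruct (Rle_dec t 1); destruct (Rle_dec 0 _); lra.
Qed.

Lemma clamp_lipschitz x y : Rabs (clamp x - clamp y) <= Rabs (x - y).
Proof.
  unfold clamp, Rmax, Rmin.
  destruct (Rle_dec x 1); destruct (Rle_dec y 1); repeat destruct (Rle_dec 0 _);
    unfold Rabs; repeat destruct (Rcase_abs _); lra.
Qed.

Lemma C1_extension_unit (f f' : R -> R) :
  C1_on unit_interval f f' ->
  exists F, (forall x, is_derive F x (f' (clamp x))) /\
            (forall x, continuous (fun t => f' (clamp t)) x) /\
            (forall x, unit_interval x -> F x = f x).
Proof.
  apply C1_extension with (x0 := 0);
    auto using clamp_unit, clamp_id, clamp_lipschitz; unfold unit_interval; intros; lra.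
Qed.

Lemma C1_extension_nonneg (f f' : R -> R) :
  C1_on nonneg_reals f f' ->
  exists F, (forall x, is_derive F x (f' (Rmax 0 x))) /\
            (forall x, continuous (fun t => f' (Rmax 0 t)) x) /\
            (forall x, nonneg_reals x -> F x = f x).
Proof.
  apply C1_extension with (x0 := 0); unfold nonneg_reals; intros.
  - apply Rmax_l.
  - now apply Rmax_right.
  - unfold Rmax, Rabs. repeat destruct (Rle_dec 0 _); repeat destruct (Rcase_abs _); lra.
  - lra.
  - lra.
Qed.

Lemma smooth_on_C1 D f : smooth_on D f ->
  exists g f', (forall x, D x -> g x = f x) /\ C1_on D g f'.
Proof.
  intros [F [H0 HF]]. exists (F 0%nat), (F 1%nat). repeat split; auto.
  intros x Dx. apply filterlim_locally. intros eps.
  destruct (cont_deriv _ _ _ _ (HF 1%nat x Dx) eps (cond_pos eps)) as [d [Hd0 Hd]].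
  exists (mkposreal d Hd0). intros y Hy Dy.
  destruct (Req_dec y x) as [->|ne]; [apply ball_center|].
  apply Hd. split; [split; auto|exact Hy].
Qed.

Lemma continuous_sqrt_squares (f g h : R -> R) x :
  continuous f x -> continuous g x -> continuous h x ->
  continuous (fun t => sqrt (f t ^ 2 + g t ^ 2 + h t ^ 2)) x.
Proof.
  intros Hf Hg Hh.
  apply (continuous_comp (fun t => f t ^ 2 + g t ^ 2 + h t ^ 2) sqrt);
    [|apply continuous_sqrt].
  assert (sq : forall k : R -> R, continuous k x -> continuous (fun t => k t ^ 2) x).
  { intros k Hk. apply (continuous_ext (fun t => k t * k t)); [intros; simpl; ring|].
    now apply (continuous_mult k k). }
  apply (continuous_plus (fun t => f t ^ 2 + g t ^ 2)); auto.
  apply (continuous_plus (fun t => f t ^ 2)); auto.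
Qed.

(** * Lengths of curves on a surface of revolution *)

Lemma constant_of_is_derive_0 (f : R -> R) a b :
  a <= b -> (forall x, a <= x <= b -> is_derive f x 0) -> f b = f a.
Proof.
  intros Hab Hf.
  destruct (MVT_gen f a b (fun _ => 0)) as [c [_ E]];
    try rewrite Rmin_left, Rmax_right by assumption.
  - intros x Hx; apply Hf; lra.
  - intros x Hx; eapply is_derive_continuity_pt; now apply Hf.
  - lra.
Qed.

(** The derivative of the direction [(x, y) / s] is the angular velocity [w]
    times its rotation by a right angle, which is undone by rotating back by
    [theta]. *)
Lemma rotated_direction_derivative (x y s theta : R -> R) (x' y' w t : R) :
  is_derive x t x' -> is_derive y t y' -> is_derive theta t w ->
  is_derive s t ((x t * x' + y t * y') / s t) ->
  0 < s t -> s t * s t = x t ^ 2 + y t ^ 2 ->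
  w * (x t ^ 2 + y t ^ 2) = x t * y' - y t * x' ->
  is_derive (fun t => (x t * cos (theta t) + y t * sin (theta t)) / s t) t 0.
Proof.
  intros Hx Hy Htheta ds spos sqr Hw. auto_derive.
  - repeat split; try (eexists; eassumption). lra.
  - assert (E1 : Derive (fun t : R => x t) t = _) by (apply is_derive_unique, Hx).
    assert (E2 : Derive (fun t : R => y t) t = _) by (apply is_derive_unique, Hy).
    assert (E3 : Derive (fun t : R => s t) t = _) by (apply is_derive_unique, ds).
    assert (E4 : Derive (fun t : R => theta t) t = _)
      by (apply is_derive_unique, Htheta).
    rewrite E1, E2, E3, E4.
    replace w with ((x t * y' - y t * x') / (s t * s t))
      by (rewrite <- Hw, <- sqr; field; lra).
    field_simplify_eq; [|lra].
    replace (s t ^ 2) with (x t ^ 2 + y t ^ 2) by (rewrite <- sqr; ring).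
    ring.
Qed.

(** A polar angle for a plane curve avoiding the origin: the integral of
    [(x y' - y x') / (x^2 + y^2)].  Rotating the curve back by this angle gives a
    curve of constant direction. *)
Lemma polar_angle (x y x' y' w theta : R -> R) :
  (forall t, 0 <= t <= 1 -> is_derive x t (x' t)) ->
  (forall t, 0 <= t <= 1 -> is_derive y t (y' t)) ->
  (forall t, 0 <= t <= 1 -> is_derive theta t (w t)) ->
  (forall t, 0 <= t <= 1 -> 0 < x t ^ 2 + y t ^ 2) ->
  (forall t, 0 <= t <= 1 ->
     w t * (x t ^ 2 + y t ^ 2) = x t * y' t - y t * x' t) ->
  x 0 = sqrt (x 0 ^ 2 + y 0 ^ 2) * cos (theta 0) ->
  y 0 = sqrt (x 0 ^ 2 + y 0 ^ 2) * sin (theta 0) ->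
  x 1 = sqrt (x 1 ^ 2 + y 1 ^ 2) * cos (theta 1) /\
  y 1 = sqrt (x 1 ^ 2 + y 1 ^ 2) * sin (theta 1).
Proof.
  intros Hx Hy Htheta Hpos Hw Ex0 Ey0.
  set (s := fun t => sqrt (x t ^ 2 + y t ^ 2)).
  set (A := fun t => (x t * cos (theta t) + y t * sin (theta t)) / s t).
  set (B := fun t => (- x t * sin (theta t) + y t * cos (theta t)) / s t).
  assert (spos : forall t, 0 <= t <= 1 -> 0 < s t) by
    (intros t Ht; apply sqrt_lt_R0; auto).
  assert (sqr : forall t, 0 <= t <= 1 -> s t * s t = x t ^ 2 + y t ^ 2).
  { intros t Ht. apply sqrt_sqrt. left; auto. }
  assert (trig : forall t, sin (theta t) ^ 2 + cos (theta t) ^ 2 = 1).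
  { intros t. rewrite <- !Rsqr_pow2. apply sin2_cos2. }
  assert (ds : forall t, 0 <= t <= 1 ->
            is_derive s t ((x t * x' t + y t * y' t) / s t)).
  { intros t Ht. specialize (Hx t Ht). specialize (Hy t Ht).
    specialize (Hpos t Ht). specialize (spos t Ht).
    change (is_derive (fun t => sqrt (x t ^ 2 + y t ^ 2)) t
              ((x t * x' t + y t * y' t) / s t)).
    auto_derive.
    - split; [eexists; exact Hx|split; [eexists; exact Hy|split; [|trivial]]].
      simpl in Hpos. exact Hpos.
    - assert (E1 : Derive (fun t : R => x t) t = _) by (apply is_derive_unique, Hx).
      assert (E2 : Derive (fun t : R => y t) t = _) by (apply is_derive_unique, Hy).
      rewrite E1, E2.
      replace (x t * (x t * 1) + y t * (y t * 1)) with (x t ^ 2 + y t ^ 2) by ring.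
      fold (s t). field. lra. }
  assert (dA : forall t, 0 <= t <= 1 -> is_derive A t 0).
  { intros t Ht. apply (rotated_direction_derivative x y s theta (x' t) (y' t) (w t));
      auto. }
  (* [B] is [A] for the curve rotated by a right angle *)
  assert (dB : forall t, 0 <= t <= 1 -> is_derive B t 0).
  { intros t Ht.
    apply (is_derive_ext
      (fun t => (y t * cos (theta t) + - x t * sin (theta t)) / s t)).
    - intros u. unfold B. f_equal. apply Rplus_comm.
    - apply (rotated_direction_derivative y (fun t => - x t) s theta
               (y' t) (- x' t) (w t)); auto.
      + now apply (is_derive_opp x), Hx.
      + replace (y t * y' t + - x t * - x' t) with (x t * x' t + y t * y' t) by ring.
        now apply ds.
      + rewrite sqr by assumption. ring.
      + transitivity (w t * (x t ^ 2 + y t ^ 2)); [ring|]. rewrite Hw by assumption. ring. }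
  assert (A1 : A 1 = 1).
  { rewrite (constant_of_is_derive_0 A 0 1) by (lra || auto).
    assert (0 < s 0) by (apply spos; lra). fold (s 0) in Ex0, Ey0.
    unfold A. rewrite Ex0, Ey0. specialize (trig 0).
    apply Rmult_eq_reg_r with (s 0); [|lra]. field_simplify; [|lra..].
    replace (s 0 * cos (theta 0) ^ 2 + s 0 * sin (theta 0) ^ 2) with
      (s 0 * (sin (theta 0) ^ 2 + cos (theta 0) ^ 2)) by ring. rewrite trig. ring. }
  assert (B1 : B 1 = 0).
  { rewrite (constant_of_is_derive_0 B 0 1) by (lra || auto).
    assert (0 < s 0) by (apply spos; lra). fold (s 0) in Ex0, Ey0.
    unfold B. rewrite Ex0, Ey0. unfold Rdiv. ring. }
  assert (s1 : 0 < s 1) by (apply spos; lra).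
  fold (s 1). specialize (trig 1).
  assert (A1' : x 1 * cos (theta 1) + y 1 * sin (theta 1) = s 1).
  { transitivity (A 1 * s 1); [unfold A; field; lra|rewrite A1; ring]. }
  assert (B1' : - x 1 * sin (theta 1) + y 1 * cos (theta 1) = 0).
  { transitivity (B 1 * s 1); [unfold B; field; lra|rewrite B1; ring]. }
  split.
  - transitivity (x 1 * (sin (theta 1) ^ 2 + cos (theta 1) ^ 2)); [rewrite trig; ring|].
    rewrite <- A1'.
    transitivity ((x 1 * cos (theta 1) + y 1 * sin (theta 1)) * cos (theta 1)
       - (- x 1 * sin (theta 1) + y 1 * cos (theta 1)) * sin (theta 1)); [ring|].
    rewrite B1'; ring.
  - transitivity (y 1 * (sin (theta 1) ^ 2 + cos (theta 1) ^ 2)); [rewrite trig; ring|].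
    rewrite <- A1'.
    transitivity ((x 1 * cos (theta 1) + y 1 * sin (theta 1)) * sin (theta 1)
       + (- x 1 * sin (theta 1) + y 1 * cos (theta 1)) * cos (theta 1)); [ring|].
    rewrite B1'; ring.
Qed.

Lemma revolution_surface_radius r x y z :
  (forall z, 0 <= z -> 0 < r z) -> revolution_surface r (x, y, z) ->
  0 <= z /\ sqrt (x ^ 2 + y ^ 2) = r z /\ x ^ 2 + y ^ 2 = r z ^ 2.
Proof.
  intros r_pos (theta & z' & Hz & [= -> -> ->]).
  split; [assumption|].
  assert (E : (r z' * cos theta) ^ 2 + (r z' * sin theta) ^ 2 = r z' ^ 2).
  { pose proof (sin2_cos2 theta) as T. rewrite !Rsqr_pow2 in T.
    transitivity (r z' ^ 2 * (sin theta ^ 2 + cos theta ^ 2)); [ring|].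
    rewrite T; ring. }
  split; [|assumption]. rewrite E. apply sqrt_pow2. left; auto.
Qed.

(** Length of a vector by duality: it suffices to bound its scalar product with
    every unit vector. *)
Lemma norm_le_of_scalar_products u v l :
  (forall al be, al ^ 2 + be ^ 2 <= 1 -> al * u + be * v <= l) ->
  sqrt (u ^ 2 + v ^ 2) <= l.
Proof.
  intros H. destruct (Req_dec (u ^ 2 + v ^ 2) 0) as [E|E].
  - rewrite E, sqrt_0. specialize (H 0 0). lra.
  - assert (P : 0 < u ^ 2 + v ^ 2) by nra.
    set (s := sqrt (u ^ 2 + v ^ 2)).
    assert (Hs : 0 < s) by now apply sqrt_lt_R0.
    assert (Hss : s * s = u ^ 2 + v ^ 2) by (apply sqrt_sqrt; lra).
    specialize (H (u / s) (v / s)).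
    replace ((u / s) ^ 2 + (v / s) ^ 2) with ((u ^ 2 + v ^ 2) / (s * s)) in H
      by (field; lra).
    replace (u / s * u + v / s * v) with ((u ^ 2 + v ^ 2) / s) in H by (field; lra).
    rewrite <- Hss in H.
    replace (s * s / (s * s)) with 1 in H by (field; lra).
    replace (s * s / s) with s in H by (field; lra). apply H; lra.
Qed.

Lemma scalar_product_le al be u v :
  al ^ 2 + be ^ 2 <= 1 -> al * u + be * v <= sqrt (u ^ 2 + v ^ 2).
Proof.
  intros H. apply Rle_trans with (Rabs (al * u + be * v)); [apply Rle_abs|].
  rewrite <- sqrt_Rsqr_abs. apply sqrt_le_1_alt. unfold Rsqr.
  assert (0 <= (al * v - be * u) ^ 2) by apply pow2_ge_0.
  assert (0 <= u ^ 2 + v ^ 2) by nra. nra.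
Qed.

Lemma dist_euc_sqrt x y x' y' :
  dist_euc x y x' y' = sqrt ((x' - x) ^ 2 + (y' - y) ^ 2).
Proof. unfold dist_euc. f_equal. unfold Rsqr. ring. Qed.

(** Since the radius is at least [R0], projecting radially onto the cylinder of
    radius [R0] and unrolling it does not increase lengths. *)
Lemma arc_length_lower_bound (r : R -> R) R0 (x y z x' y' z' : R -> R) theta0 z0 :
  (forall z, 0 <= z -> 0 < r z) -> 0 < R0 -> (forall z, 0 <= z -> R0 <= r z) ->
  C1_on unit_interval x x' -> C1_on unit_interval y y' -> C1_on unit_interval z z' ->
  (forall t, unit_interval t -> revolution_surface r (x t, y t, z t)) ->
  (x 0, y 0, z 0) = revolution_param r theta0 z0 ->
  exists theta1 z1, 0 <= z1 /\ (x 1, y 1, z 1) = revolution_param r theta1 z1 /\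
    dist_euc (R0 * theta0) z0 (R0 * theta1) z1 <=
    RInt (fun t => sqrt (x' t ^ 2 + y' t ^ 2 + z' t ^ 2)) 0 1.
Proof.
  intros r_pos R0_pos r_ge Cx Cy Cz HS E0.
  destruct (C1_extension_unit x x' Cx) as (X & dX & cX & eX).
  destruct (C1_extension_unit y y' Cy) as (Y & dY & cY & eY).
  destruct (C1_extension_unit z z' Cz) as (Z & dZ & cZ & eZ).
  assert (U : forall t, 0 <= t <= 1 -> clamp t = t) by (intros; now apply clamp_id).
  assert (rad : forall t, 0 <= t <= 1 ->
    0 <= Z t /\ sqrt (X t ^ 2 + Y t ^ 2) = r (Z t) /\ X t ^ 2 + Y t ^ 2 = r (Z t) ^ 2).
  { intros t Ht. rewrite eX, eY, eZ by exact Ht.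
    apply revolution_surface_radius; auto. }
  assert (pos : forall t, 0 <= t <= 1 -> R0 ^ 2 <= X t ^ 2 + Y t ^ 2).
  { intros t Ht. destruct (rad t Ht) as (Hz & _ & ->). specialize (r_ge _ Hz).
    apply pow_incr; lra. }
  set (w := fun t => (X (clamp t) * y' (clamp t) - Y (clamp t) * x' (clamp t))
                     / (X (clamp t) ^ 2 + Y (clamp t) ^ 2)).
  assert (cclamp : forall t, continuous clamp t).
  { intros t. apply filterlim_locally. intros eps. exists eps. intros s Hs.
    change (Rabs (clamp s - clamp t) < eps). change (Rabs (s - t) < eps) in Hs.
    pose proof (clamp_lipschitz s t). lra. }
  assert (cXc : forall t, continuous (fun t => X (clamp t)) t).
  { intros t. apply continuous_comp; [apply cclamp|].
    apply (ex_derive_continuous (V := R_NormedModule)). eexists; apply dX. }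
  assert (cYc : forall t, continuous (fun t => Y (clamp t)) t).
  { intros t. apply continuous_comp; [apply cclamp|].
    apply (ex_derive_continuous (V := R_NormedModule)). eexists; apply dY. }
  assert (cw : forall t, continuous w t).
  { intros t. unfold w, Rdiv.
    apply (continuous_mult (fun t => X (clamp t) * y' (clamp t) - Y (clamp t) * x' (clamp t))
             (fun t => / (X (clamp t) ^ 2 + Y (clamp t) ^ 2))).
    - apply (continuous_minus (fun t => X (clamp t) * y' (clamp t))
               (fun t => Y (clamp t) * x' (clamp t)));
        apply (continuous_mult (K := R_AbsRing)); auto.
    - apply (continuous_comp (fun t => X (clamp t) ^ 2 + Y (clamp t) ^ 2) Rinv).
      + apply (continuous_ext (fun t => X (clamp t) * X (clamp t) + Y (clamp t) * Y (clamp t)));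
          [intros; simpl; ring|].
        apply (continuous_plus (fun t => X (clamp t) * X (clamp t))
                 (fun t => Y (clamp t) * Y (clamp t)));
          apply (continuous_mult (K := R_AbsRing)); auto.
      + apply continuous_Rinv. pose proof (pos _ (clamp_unit t)). nra. }
  set (theta := fun t => theta0 + RInt w 0 t).
  assert (dtheta : forall t, is_derive theta t (w t)).
  { intros t. rewrite <- (Rplus_0_l (w t)). unfold theta.
    apply (is_derive_plus (fun _ => theta0));
      [apply is_derive_Reals, derivable_pt_lim_const|].
    apply (is_derive_RInt w (RInt w 0) 0 t); [|apply cw].
    exists (mkposreal 1 Rlt_0_1). intros s _. apply (RInt_correct w).
    apply (ex_RInt_continuous w); auto. }
  assert (theta00 : theta 0 = theta0).
  { unfold theta. rewrite RInt_point. apply Rplus_0_r. }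
  injection E0 as Ex0 Ey0 Ez0.
  assert (I0 : unit_interval 0) by (unfold unit_interval; lra).
  assert (I1 : unit_interval 1) by (unfold unit_interval; lra).
  destruct (polar_angle X Y (fun t => x' (clamp t)) (fun t => y' (clamp t)) w theta)
    as [EX1 EY1]; auto.
  - intros t Ht. pose proof (pos t Ht). nra.
  - intros t Ht. unfold w. rewrite !U by assumption. field.
    pose proof (pos t Ht). nra.
  - destruct (rad 0 I0) as (_ & -> & _).
    rewrite theta00, eX, eZ, Ez0 by assumption. exact Ex0.
  - destruct (rad 0 I0) as (_ & -> & _).
    rewrite theta00, eY, eZ, Ez0 by assumption. exact Ey0.
  - destruct (rad 1 I1) as (Hz1 & Es1 & _). rewrite Es1 in EX1, EY1.
    exists (theta 1), (Z 1). split; [assumption|]. split.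
    { unfold revolution_param. rewrite <- EX1, <- EY1, eX, eY, eZ by assumption.
      reflexivity. }
    rewrite dist_euc_sqrt. apply norm_le_of_scalar_products. intros al be Hab.
    set (F := fun t => al * (R0 * theta t) + be * Z t).
    assert (dF : forall t, is_derive F t (al * (R0 * w t) + be * z' (clamp t))).
    { intros t. apply (is_derive_plus (fun t => al * (R0 * theta t)) (fun t => be * Z t)).
      - apply is_derive_scal, is_derive_scal, dtheta.
      - apply is_derive_scal, dZ. }
    assert (IF : is_RInt (fun t => al * (R0 * w t) + be * z' (clamp t)) 0 1 (F 1 - F 0)).
    { apply (is_RInt_derive F); [intros; apply dF|]. intros t _.
      apply (continuous_plus (fun t => al * (R0 * w t)) (fun t => be * z' (clamp t))).
      - apply (continuous_scal_r al (fun t => R0 * w t)).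
        apply (continuous_scal_r R0 w), cw.
      - apply (continuous_scal_r be (fun t => z' (clamp t))), cZ. }
    replace (al * (R0 * theta 1 - R0 * theta0) + be * (Z 1 - z0)) with (F 1 - F 0).
    2:{ unfold F. rewrite theta00, (eZ 0), Ez0 by assumption. ring. }
    rewrite <- (is_RInt_unique _ _ _ _ IF).
    rewrite (RInt_ext (fun t => sqrt (x' t ^ 2 + y' t ^ 2 + z' t ^ 2))
      (fun t => sqrt (x' (clamp t) ^ 2 + y' (clamp t) ^ 2 + z' (clamp t) ^ 2))).
    2:{ intros t Ht. rewrite Rmin_left, Rmax_right in Ht by lra.
        rewrite U by lra. reflexivity. }
    apply RInt_le; [lra|eexists; exact IF| |].
    + apply (ex_RInt_continuous (fun t => sqrt (x' (clamp t) ^ 2 + y' (clamp t) ^ 2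
                                                + z' (clamp t) ^ 2))).
      intros; apply continuous_sqrt_squares; auto.
    + intros t Ht. eapply Rle_trans; [now apply scalar_product_le|].
      apply sqrt_le_1_alt. apply Rplus_le_compat_r.
      unfold w. rewrite !U by lra.
      assert (P : R0 ^ 2 <= X t ^ 2 + Y t ^ 2) by (apply pos; lra).
      set (S := X t ^ 2 + Y t ^ 2) in *. set (W := X t * y' t - Y t * x' t).
      assert (0 < R0 ^ 2) by nra.
      (* the difference of both sides is [(x x' + y y')^2] *)
      assert (CS : W ^ 2 <= S * (x' t ^ 2 + y' t ^ 2)).
      { unfold W, S. assert (0 <= (X t * x' t + Y t * y' t) ^ 2) by apply pow2_ge_0.
        nra. }
      apply Rle_trans with (S * (W / S) ^ 2).
      * replace ((R0 * (W / S)) ^ 2) with (R0 ^ 2 * (W / S) ^ 2) by ring.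
        apply Rmult_le_compat_r; [apply pow2_ge_0|assumption].
      * apply Rmult_le_reg_l with S; [lra|].
        replace (S * (S * (W / S) ^ 2)) with (W ^ 2) by (field; lra). assumption.
Qed.

(** The lift of a concatenation is the concatenation of the lifts. *)
Lemma curve_length_lower_bound (r : R -> R) R0 P Q l :
  (forall z, 0 <= z -> 0 < r z) -> 0 < R0 -> (forall z, 0 <= z -> R0 <= r z) ->
  curve_length (revolution_surface r) P Q l ->
  forall theta0 z0, P = revolution_param r theta0 z0 ->
  exists theta1 z1, 0 <= z1 /\ Q = revolution_param r theta1 z1 /\
    dist_euc (R0 * theta0) z0 (R0 * theta1) z1 <= l.
Proof.
  intros r_pos R0_pos r_ge Hc.
  induction Hc as [x y z x' y' z' Cx Cy Cz HS|P Q T l m _ IH1 _ IH2]; intros theta0 z0 E.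
  - now apply arc_length_lower_bound.
  - destruct (IH1 _ _ E) as (theta1 & z1 & _ & E1 & L1).
    destruct (IH2 _ _ E1) as (theta2 & z2 & Hz2 & E2 & L2).
    exists theta2, z2. split; [assumption|split; [assumption|]].
    eapply Rle_trans; [apply (triangle _ _ _ _ (R0 * theta1) z1)|].
    now apply Rplus_le_compat.
Qed.

Lemma sum_squares_nonneg a b : 0 <= a ^ 2 + b ^ 2.
Proof. apply Rplus_le_le_0_compat; apply pow2_ge_0. Qed.

Lemma increasing_derivative_nonneg (f f' : R -> R) x :
  nonneg_reals x -> D_in f f' nonneg_reals x ->
  (forall u v, 0 <= u -> u <= v -> f u <= f v) -> 0 <= f' x.
Proof.
  unfold nonneg_reals. intros Hx Hd incr.
  destruct (Rle_lt_dec 0 (f' x)) as [H|H]; [assumption|exfalso].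
  destruct (Hd (- f' x) ltac:(lra)) as [d [Hd0 Hd1]].
  specialize (Hd1 (x + d / 2)). simpl in Hd1. unfold R_dist in Hd1.
  assert (Hlt : Rabs ((f (x + d / 2) - f x) / (x + d / 2 - x) - f' x) < - f' x).
  { apply Hd1. split; [split; [unfold nonneg_reals|]; lra|].
    rewrite Rabs_right; lra. }
  apply Rabs_lt_between in Hlt.
  assert (0 <= (f (x + d / 2) - f x) / (x + d / 2 - x)); [|lra].
  apply Rmult_le_pos; [|left; apply Rinv_0_lt_compat; lra].
  assert (f x <= f (x + d / 2)) by (apply incr; lra). lra.
Qed.

(** Realised by the helix.  As [r] is monotone, its total variation along the
    helix is its increment, whatever the size of [r']. *)
Lemma helix_length (r : R -> R) theta0 z0 theta1 z1 delta :
  (forall z, 0 <= z -> 0 < r z) ->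
  (forall z1 z2, 0 <= z1 -> z1 <= z2 -> r z1 <= r z2) ->
  smooth_on nonneg_reals r ->
  0 <= z0 <= delta -> 0 <= z1 <= delta ->
  exists l, curve_length (revolution_surface r)
              (revolution_param r theta0 z0) (revolution_param r theta1 z1) l /\
    l <= dist_euc (r delta * theta0) z0 (r delta * theta1) z1 + Rabs (r z1 - r z0).
Proof.
  intros r_pos r_incr r_smooth Hz0 Hz1.
  destruct (smooth_on_C1 _ _ r_smooth) as (g & g' & eg & Cg).
  assert (g'_pos : forall z, 0 <= z -> 0 <= g' z).
  { intros z Hz. apply (increasing_derivative_nonneg g); [exact Hz|now apply Cg|].
    intros u v Hu Huv. rewrite !eg by (unfold nonneg_reals; lra). auto. }
  destruct (C1_extension_nonneg g g' Cg) as (F & dF & cF & eF).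
  assert (EF : forall z, 0 <= z -> F z = r z) by (intros; rewrite eF, eg; auto).
  set (F' := fun t => g' (Rmax 0 t)) in *.
  assert (F'_pos : forall t, 0 <= F' t) by (intros; apply g'_pos, Rmax_l).
  set (dz := z1 - z0). set (dth := theta1 - theta0).
  set (zz := fun t => z0 + t * dz). set (th := fun t => theta0 + t * dth).
  assert (zz_range : forall t, 0 <= t <= 1 -> 0 <= zz t <= delta).
  { intros t Ht. unfold zz, dz. split; nra. }
  assert (dzz : forall t, is_derive zz t dz).
  { intros t. unfold zz. auto_derive; [trivial|ring]. }
  assert (dth' : forall t, is_derive th t dth).
  { intros t. unfold th. auto_derive; [trivial|ring]. }
  assert (dFz : forall t, is_derive (fun t => F (zz t)) t (F' (zz t) * dz)).
  { intros t. rewrite Rmult_comm. apply (is_derive_comp F zz); [apply dF|apply dzz]. }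
  set (p := fun t => F' (zz t) * dz). set (q := fun t => F (zz t) * dth).
  set (x := fun t => F (zz t) * cos (th t)). set (y := fun t => F (zz t) * sin (th t)).
  set (x' := fun t => p t * cos (th t) - q t * sin (th t)).
  set (y' := fun t => p t * sin (th t) + q t * cos (th t)).
  assert (cder : forall (f f' : R -> R), (forall t, is_derive f t (f' t)) ->
            forall t, continuous f t).
  { intros f f' Hf t. apply (ex_derive_continuous (V := R_NormedModule)).
    eexists; apply Hf. }
  assert (dcos : forall t, is_derive (fun t => cos (th t)) t (- dth * sin (th t))).
  { intros t. unfold th. auto_derive; [trivial|ring]. }
  assert (dsin : forall t, is_derive (fun t => sin (th t)) t (dth * cos (th t))).
  { intros t. unfold th. auto_derive; [trivial|ring]. }
  assert (dx : forall t, is_derive x t (x' t)).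
  { intros t. unfold x, x', p, q.
    replace (F' (zz t) * dz * cos (th t) - F (zz t) * dth * sin (th t)) with
      (F' (zz t) * dz * cos (th t) + F (zz t) * (- dth * sin (th t))) by ring.
    apply (is_derive_mult (fun t => F (zz t)) (fun t => cos (th t)));
      [apply dFz|apply dcos|intros; apply Rmult_comm]. }
  assert (dy : forall t, is_derive y t (y' t)).
  { intros t. unfold y, y', p, q.
    replace (F (zz t) * dth * cos (th t)) with (F (zz t) * (dth * cos (th t))) by ring.
    apply (is_derive_mult (fun t => F (zz t)) (fun t => sin (th t)));
      [apply dFz|apply dsin|intros; apply Rmult_comm]. }
  assert (cp : forall t, continuous p t).
  { intros t. apply (continuous_mult (K := R_AbsRing)); [|apply continuous_const].
    apply (continuous_comp zz F'); [eapply cder; apply dzz|apply cF]. }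
  assert (cq : forall t, continuous q t).
  { intros t. apply (continuous_mult (K := R_AbsRing)); [|apply continuous_const].
    eapply cder; apply dFz. }
  assert (ccos : forall t, continuous (fun t => cos (th t)) t) by exact (cder _ _ dcos).
  assert (csin : forall t, continuous (fun t => sin (th t)) t) by exact (cder _ _ dsin).
  assert (cx' : forall t, continuous x' t).
  { intros t. apply (continuous_minus (fun t => p t * cos (th t)) (fun t => q t * sin (th t)));
      apply (continuous_mult (K := R_AbsRing)); auto. }
  assert (cy' : forall t, continuous y' t).
  { intros t. apply (continuous_plus (fun t => p t * sin (th t)) (fun t => q t * cos (th t)));
      apply (continuous_mult (K := R_AbsRing)); auto. }
  assert (ends : forall t, (t = 0 \/ t = 1) -> forall theta z, theta = th t -> z = zz t ->
            revolution_param r theta z = (x t, y t, zz t)).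
  { intros t Ht theta z -> ->. unfold revolution_param, x, y.
    rewrite EF; [reflexivity|]. apply zz_range. destruct Ht; lra. }
  exists (RInt (fun t => sqrt (x' t ^ 2 + y' t ^ 2 + (fun _ => dz) t ^ 2)) 0 1). split.
  { rewrite (ends 0), (ends 1); auto; try (unfold th, dth; ring); try (unfold zz, dz; ring).
    apply curve_arc; try (now apply C1_on_of_is_derive).
    - apply C1_on_of_is_derive; [assumption|intros; apply continuous_const].
    - intros t Ht. exists (th t), (zz t). split; [now apply zz_range|].
      unfold revolution_param, x, y. rewrite EF by now apply zz_range. reflexivity. }
  set (L := dist_euc (r delta * theta0) z0 (r delta * theta1) z1).
  (* as [r' >= 0], [Rabs (r' * dz) = sg * r' * dz] with a constant sign, hence it
     has a primitive *)
  assert (exists sg, sg * dz = Rabs dz /\ (sg = 1 \/ sg = -1)) as (sg & Hsg & Hsg').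
  { destruct (Rle_lt_dec 0 dz).
    - exists 1. rewrite Rabs_right by lra. split; [ring|auto].
    - exists (-1). rewrite Rabs_left by lra. split; [ring|auto]. }
  assert (I : is_RInt (fun t => L + sg * p t) 0 1 (L + sg * (r z1 - r z0))).
  { replace (L + sg * (r z1 - r z0)) with
      ((fun t => t * L + sg * F (zz t)) 1 - (fun t => t * L + sg * F (zz t)) 0).
    - apply (is_RInt_derive (fun t => t * L + sg * F (zz t))).
      + intros t _. apply (is_derive_plus (fun t => t * L) (fun t => sg * F (zz t))).
        * auto_derive; [trivial|ring].
        * apply is_derive_scal, dFz.
      + intros t _. apply (continuous_plus (fun _ => L) (fun t => sg * p t)).
        * apply continuous_const.
        * apply (continuous_scal_r sg p), cp.
    - replace (zz 1) with z1 by (unfold zz, dz; ring).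
      replace (zz 0) with z0 by (unfold zz, dz; ring).
      rewrite !EF by lra. ring. }
  apply Rle_trans with (L + sg * (r z1 - r z0)).
  2:{ apply Rplus_le_compat_l.
      pose proof (Rle_abs (r z1 - r z0)) as V1.
      pose proof (Rle_abs (- (r z1 - r z0))) as V2. rewrite Rabs_Ropp in V2.
      destruct Hsg' as [-> | ->]; lra. }
  rewrite <- (is_RInt_unique _ _ _ _ I).
  apply RInt_le; [lra| |eexists; exact I|].
  - apply (ex_RInt_continuous (fun t => sqrt (x' t ^ 2 + y' t ^ 2 + dz ^ 2))).
    intros; apply (continuous_sqrt_squares x' y' (fun _ => dz)); auto.
    apply continuous_const.
  - intros t Ht.
    assert (Er : x' t ^ 2 + y' t ^ 2 = p t ^ 2 + q t ^ 2).
    { unfold x', y'. pose proof (sin2_cos2 (th t)) as T. rewrite !Rsqr_pow2 in T.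
      transitivity ((p t ^ 2 + q t ^ 2) * (sin (th t) ^ 2 + cos (th t) ^ 2)); [ring|].
      rewrite T; ring. }
    rewrite Er.
    assert (Ep : 0 <= sg * p t).
    { unfold p. replace (sg * (F' (zz t) * dz)) with (F' (zz t) * (sg * dz)) by ring.
      rewrite Hsg. apply Rmult_le_pos; [apply F'_pos|apply Rabs_pos]. }
    assert (Ep2 : (sg * p t) ^ 2 = p t ^ 2) by (destruct Hsg' as [-> | ->]; ring).
    assert (L0 : 0 <= L) by apply sqrt_pos.
    assert (Lq : q t ^ 2 + dz ^ 2 <= L ^ 2).
    { unfold L. rewrite dist_euc_sqrt, pow2_sqrt by apply sum_squares_nonneg. apply Rplus_le_compat_r.
      unfold q. rewrite EF by (apply zz_range; lra).
      replace ((r delta * theta1 - r delta * theta0) ^ 2) with (r delta ^ 2 * dth ^ 2)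
        by (unfold dth; ring).
      rewrite Rpow_mult_distr.
      apply Rmult_le_compat_r; [apply pow2_ge_0|].
      destruct (zz_range t) as [Z1 Z2]; [lra|].
      apply pow_incr. split; [left; auto|auto]. }
    rewrite <- (sqrt_pow2 (L + sg * p t)) by lra.
    apply sqrt_le_1_alt. nra.
Qed.

Lemma geodesic_distance_between S P Q lo :
  (forall l, curve_length S P Q l -> lo <= l) ->
  forall l, curve_length S P Q l ->
  lo <= geodesic_distance S P Q <= l.
Proof.
  intros Hlo l Hl. unfold geodesic_distance.
  destruct (Glb_Rbar_correct (curve_length S P Q)) as [G1 G2].
  specialize (G1 l Hl). specialize (G2 (Finite lo)).
  assert (G3 : Rbar_le lo (Glb_Rbar (curve_length S P Q))).
  { apply G2. intros l' Hl'. simpl. auto. }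
  destruct (Glb_Rbar (curve_length S P Q)); simpl in *; tauto || lra.
Qed.

(** * Distances on a grid of points close to the shortest parallel *)

Lemma cos_sin_period theta (q : Z) :
  cos (theta + 2 * IZR q * PI) = cos theta /\ sin (theta + 2 * IZR q * PI) = sin theta.
Proof.
  destruct (Z_le_gt_dec 0 q) as [H|H].
  - rewrite <- (Z2Nat.id q), <- INR_IZR_INZ by assumption.
    split; [apply cos_period|apply sin_period].
  - rewrite <- (cos_period _ (Z.to_nat (- q))), <- (sin_period (_ + _) (Z.to_nat (- q))).
    rewrite INR_IZR_INZ, Z2Nat.id, opp_IZR by lia.
    split; f_equal; ring.
Qed.

Lemma equal_angles theta theta' :
  cos theta = cos theta' -> sin theta = sin theta' ->
  exists q : Z, theta' = theta + 2 * IZR q * PI.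
Proof.
  intros Ec Es.
  assert (C : cos (theta' - theta) = 1).
  { rewrite cos_minus, Ec, Es, Rplus_comm. apply sin2_cos2. }
  replace (theta' - theta) with (2 * ((theta' - theta) / 2)) in C by field.
  rewrite cos_2a_sin in C.
  destruct (sin_eq_0_0 ((theta' - theta) / 2)) as [q Hq]; [nra|].
  exists q. lra.
Qed.

Lemma revolution_param_period r theta z (q : Z) :
  revolution_param r (theta + 2 * IZR q * PI) z = revolution_param r theta z.
Proof.
  unfold revolution_param. destruct (cos_sin_period theta q) as [-> ->]. reflexivity.
Qed.

(** [circle_dist] is the least distance between representatives modulo [2 n];
    [2 n - k] stands for [-k], which is not a natural number. *)
Lemma circle_dist_spec n k l :
  (1 <= n)%nat -> (k <= 2 * n)%nat ->
  let m := circle_dist n (l + (2 * n - k)) in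
  (m <= n)%nat /\
  (forall q, Z.of_nat m <= Z.abs (Z.of_nat l - Z.of_nat k + 2 * Z.of_nat n * q))%Z /\
  (exists q, Z.abs (Z.of_nat l - Z.of_nat k + 2 * Z.of_nat n * q) = Z.of_nat m)%Z.
Proof.
  intros Hn Hk m.
  set (t := ((l + (2 * n - k)) mod (2 * n))%nat).
  set (s := ((l + (2 * n - k)) / (2 * n))%nat).
  assert (Hdm : (l + (2 * n - k) = 2 * n * s + t)%nat) by (apply Nat.div_mod_eq).
  assert (Ht : (t < 2 * n)%nat) by (apply Nat.mod_upper_bound; lia).
  assert (Em : m = Nat.min t (2 * n - t)) by reflexivity.
  clearbody m s t.
  assert (D : (forall q, Z.of_nat l - Z.of_nat k + 2 * Z.of_nat n * q
              = Z.of_nat t + 2 * Z.of_nat n * (Z.of_nat s - 1 + q))%Z) by (intros; nia).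
  split; [lia|split].
  - intros q. rewrite D. set (q' := (Z.of_nat s - 1 + q)%Z).
    destruct (Z_le_gt_dec 0 q'); nia.
  - destruct (Nat.le_gt_cases t n).
    + exists (1 - Z.of_nat s)%Z. rewrite D. lia.
    + exists (- Z.of_nat s)%Z. rewrite D. lia.
Qed.

(** The spacing of the levels is the arc length between neighbours on the
    shortest parallel, so that the grid on the cylinder is a square lattice. *)
Definition grid_point (r : R -> R) n i k : R * R * R :=
  revolution_param r (INR k * (PI / INR n)) (r 0 * (PI / INR n) * INR i).

(** The cylinder of radius [r 0] gives the lower bound.  For the upper bound the
    angle between the points is at most [PI], so the helix is longer by at most
    [PI (r delta - r 0)], and the variation of [r] adds [r delta - r 0]. *)
Lemma grid_distance (r : R -> R) n i j k l N :
  (forall z, 0 <= z -> 0 < r z) ->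
  (forall z1 z2, 0 <= z1 -> z1 <= z2 -> r z1 <= r z2) ->
  smooth_on nonneg_reals r ->
  (1 <= n)%nat -> (k <= 2 * n)%nat -> (i <= N)%nat -> (j <= N)%nat ->
  let h := (i - j + (j - i))%nat in
  let m := circle_dist n (l + (2 * n - k)) in
  let c := r 0 * (PI / INR n) in
  let d := geodesic_distance (revolution_surface r)
             (grid_point r n i k) (grid_point r n j l) in
  let d0 := c * sqrt (INR m ^ 2 + INR h ^ 2) in
  d0 <= d <= d0 + (PI + 1) * (r (c * INR N) - r 0) /\
  (m = 0%nat -> h = 0%nat -> d = 0).
Proof.
  intros r_pos r_incr r_smooth Hn Hk Hi Hj h m c d d0.
  destruct (circle_dist_spec n k l Hn Hk) as (Hmn & Hlow & q & Hq).
  fold m in Hmn, Hlow, Hq.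
  assert (Hr0 : 0 < r 0) by (apply r_pos; lra).
  assert (HnR : 0 < INR n) by (apply lt_0_INR; lia).
  pose proof PI_RGT_0 as HPI.
  assert (Htau : 0 < PI / INR n) by (apply Rdiv_lt_0_compat; assumption).
  assert (Hc : 0 < c) by (apply Rmult_lt_0_compat; assumption).
  assert (level : forall a, (a <= N)%nat -> 0 <= c * INR a <= c * INR N).
  { intros a Ha. apply le_INR in Ha. pose proof (pos_INR a). split; nra. }
  assert (Hh : (INR j - INR i) ^ 2 = INR h ^ 2).
  { unfold h. rewrite plus_INR. destruct (Nat.le_ge_cases i j) as [H|H].
    - replace (i - j)%nat with 0%nat by lia. rewrite minus_INR by assumption. simpl; ring.
    - replace (j - i)%nat with 0%nat by lia. rewrite minus_INR by assumption. simpl; ring. }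
  assert (angle : forall (R0 : R) (q : Z),
    R0 * (INR l * (PI / INR n) + 2 * IZR q * PI) - R0 * (INR k * (PI / INR n)) =
    R0 * (PI / INR n) * IZR (Z.of_nat l - Z.of_nat k + 2 * Z.of_nat n * q)).
  { intros R0 q'. rewrite plus_IZR, minus_IZR, !mult_IZR, <- !INR_IZR_INZ. field. lra. }
  set (delta := c * INR N) in *.
  assert (Hrd : r 0 <= r delta) by (apply r_incr; [lra|unfold delta; pose proof (pos_INR N); nra]).
  assert (LO : forall len, curve_length (revolution_surface r)
                 (grid_point r n i k) (grid_point r n j l) len -> d0 <= len).
  { intros len Hlen.
    destruct (curve_length_lower_bound r (r 0) _ _ _ r_pos Hr0
                (fun z Hz => r_incr 0 z (Rle_refl 0) Hz) Hlen _ _ eq_refl)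
      as (theta1 & z1 & Hz1 & E & Hd).
    unfold grid_point, revolution_param in E. injection E as Ex Ey <-.
    fold c in Ex, Ey, Hd.
    assert (Hrz : 0 < r (c * INR j)) by (apply r_pos, level, Hj).
    apply Rmult_eq_reg_l in Ex; [|lra]. apply Rmult_eq_reg_l in Ey; [|lra].
    destruct (equal_angles _ _ Ex Ey) as [q' ->].
    eapply Rle_trans; [|exact Hd].
    rewrite dist_euc_sqrt, angle. fold c. unfold d0.
    rewrite <- (sqrt_pow2 c) at 1 by lra. rewrite <- sqrt_mult by nra.
    apply sqrt_le_1_alt.
    replace ((c * INR j - c * INR i) ^ 2) with (c ^ 2 * (INR j - INR i) ^ 2) by ring.
    rewrite Hh, Rpow_mult_distr, <- Rmult_plus_distr_l.
    apply Rmult_le_compat_l; [nra|]. apply Rplus_le_compat_r.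
    rewrite <- (pow2_abs (IZR _)), <- abs_IZR, INR_IZR_INZ.
    apply pow_incr. split; [apply IZR_le; lia|apply IZR_le, Hlow]. }
  assert (UP : exists len, curve_length (revolution_surface r)
                 (grid_point r n i k) (grid_point r n j l) len /\
      len <= sqrt ((r delta * (PI / INR n) * INR m) ^ 2 + c ^ 2 * INR h ^ 2)
             + Rabs (r (c * INR j) - r (c * INR i))).
  { destruct (helix_length r (INR k * (PI / INR n)) (c * INR i)
      (INR l * (PI / INR n) + 2 * IZR q * PI) (c * INR j) delta
      r_pos r_incr r_smooth (level _ Hi) (level _ Hj)) as (len & Hlen & Hle).
    rewrite revolution_param_period in Hlen. exists len. split; [exact Hlen|].
    rewrite dist_euc_sqrt, angle in Hle.
    replace ((c * INR j - c * INR i) ^ 2) with (c ^ 2 * (INR j - INR i) ^ 2) in Hle by ring.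
    rewrite Hh, Rpow_mult_distr, <- (pow2_abs (IZR _)), <- abs_IZR, Hq, <- INR_IZR_INZ,
      <- Rpow_mult_distr in Hle. exact Hle. }
  destruct UP as (len & Hlen & Hle).
  destruct (geodesic_distance_between _ _ _ d0 LO len Hlen) as [G1 G2].
  fold d in G1, G2. split; [split; [assumption|]|].
  - eapply Rle_trans; [exact G2|]. eapply Rle_trans; [exact Hle|].
    assert (Hvar : Rabs (r (c * INR j) - r (c * INR i)) <= r delta - r 0).
    { assert (V : forall a, (a <= N)%nat -> r 0 <= r (c * INR a) <= r delta)
        by (intros a Ha; destruct (level a Ha); split; apply r_incr; lra).
      pose proof (V i Hi). pose proof (V j Hj). apply Rabs_le; lra. }
    set (e := (r delta - r 0) * (PI / INR n) * INR m).
    assert (He : e <= (r delta - r 0) * PI).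
    { unfold e. apply le_INR in Hmn. rewrite Rmult_assoc.
      apply Rmult_le_compat_l; [lra|].
      replace PI with (PI / INR n * INR n) at 2 by (field; lra).
      apply Rmult_le_compat_l; lra. }
    assert (He0 : 0 <= e).
    { unfold e. apply Rmult_le_pos; [apply Rmult_le_pos; lra|apply pos_INR]. }
    assert (sqrt ((r delta * (PI / INR n) * INR m) ^ 2 + c ^ 2 * INR h ^ 2) <= d0 + e);
      [|lra].
    replace (r delta * (PI / INR n) * INR m) with (c * INR m + e) by (unfold c, e; ring).
    assert (Hd0 : 0 <= d0) by (apply Rmult_le_pos; [lra|apply sqrt_pos]).
    rewrite <- (sqrt_pow2 (d0 + e)) by lra. apply sqrt_le_1_alt.
    assert (Ed0 : d0 ^ 2 = c ^ 2 * (INR m ^ 2 + INR h ^ 2)).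
    { unfold d0. rewrite Rpow_mult_distr, pow2_sqrt by apply sum_squares_nonneg. reflexivity. }
    assert (c * INR m <= d0).
    { apply Rmult_le_compat_l; [lra|].
      rewrite <- (sqrt_pow2 (INR m)) at 1 by apply pos_INR.
      apply sqrt_le_1_alt. nra. }
    nra.
  - intros Em Eh. unfold d0 in G1. rewrite Em, Eh in *.
    simpl (INR 0) in *.
    assert (Eij : i = j) by (unfold h in Eh; lia). subst j.
    rewrite Rminus_diag, Rabs_R0 in Hle.
    replace ((r delta * (PI / INR n) * 0) ^ 2 + c ^ 2 * 0 ^ 2) with 0 in Hle by ring.
    replace (0 ^ 2 + 0 ^ 2) with 0 in G1 by ring. rewrite sqrt_0 in Hle, G1. lra.
Qed.

(** * The test configuration *)

Lemma negative_definite_kernel_array {T : Type} (S : T -> Prop) (f : T -> T -> R)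
    N K (x : nat -> nat -> T) (c : nat -> nat -> R) :
  negative_definite_kernel S f -> (1 <= K)%nat ->
  (forall i k, (1 <= i <= N)%nat -> (1 <= k <= K)%nat -> S (x i k)) ->
  sum_n_m (fun i => sum_n_m (c i) 1 K) 1 N = 0 ->
  sum_n_m (fun i => sum_n_m (fun k => sum_n_m (fun j => sum_n_m (fun l =>
    c i k * c j l * f (x i k) (x j l)) 1 K) 1 N) 1 K) 1 N <= 0.
Proof.
  intros [_ Hneg] HK HS Hc.
  set (row := fun t => Datatypes.S ((t - 1) / K)).
  set (col := fun t => Datatypes.S ((t - 1) mod K)).
  specialize (Hneg (N * K)%nat (fun t => x (row t) (col t)) (fun t => c (row t) (col t))).
  unfold row, col in Hneg. rewrite (sum_div_mod c) in Hneg.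
  rewrite <- (sum_div_mod (fun i k => sum_n_m (fun j => sum_n_m (fun l =>
    c i k * c j l * f (x i k) (x j l)) 1 K) 1 N)).
  rewrite (sum_n_m_ext _ (fun s => sum_n_m (fun t =>
    c (row s) (col s) * c (row t) (col t) * f (x (row s) (col s)) (x (row t) (col t)))
    1 (N * K))).
  - apply Hneg; [|assumption]. intros t Ht. apply HS.
    + assert ((t - 1) / K < N)%nat by (apply Nat.Div0.div_lt_upper_bound; lia). lia.
    + assert ((t - 1) mod K < K)%nat by (apply Nat.mod_upper_bound; lia). lia.
  - intros s. symmetry.
    apply (sum_div_mod (fun j l => c (row s) (col s) * c j l *
             f (x (row s) (col s)) (x j l))).
Qed.

(** The power [a <= 1] is concave, so its slope beyond [d0 >= c] is at most
    [c^(a-1)], up to the factor [a]. *)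
Lemma nonneg_power_perturbation a c d0 d eps :
  0 < a <= 1 -> 0 < c <= d0 -> d0 <= d <= d0 + eps ->
  Rabs (nonneg_power d a - nonneg_power d0 a) <= Rpower c (a - 1) * eps.
Proof.
  intros Ha Hc Hd.
  assert (Hx : 1 <= d / d0).
  { apply Rmult_le_reg_r with d0; [lra|]. unfold Rdiv.
    rewrite Rmult_assoc, Rinv_l by lra. lra. }
  replace d with (d0 * (d / d0)) by (field; lra).
  rewrite nonneg_power_mult by lra.
  rewrite (nonneg_power_pos d0) by lra.
  pose proof (nonneg_power_bernoulli (d / d0) a ltac:(lra) Ha) as B.
  assert (B0 : 1 <= nonneg_power (d / d0) a).
  { rewrite nonneg_power_pos by lra.
    apply Rle_trans with (Rpower (d / d0) 0); [rewrite Rpower_O; lra|].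
    apply Rle_Rpower; lra. }
  pose proof (Rpower_pos d0 a) as P.
  rewrite Rabs_right by nra.
  assert (B1 : nonneg_power (d / d0) a - 1 <= / d0 * eps).
  { apply Rle_trans with (d / d0 - 1); [nra|].
    replace (d / d0 - 1) with (/ d0 * (d - d0)) by (field; lra).
    apply Rmult_le_compat_l; [left; apply Rinv_0_lt_compat|]; lra. }
  apply Rle_trans with (Rpower d0 (a - 1) * eps).
  - replace (Rpower d0 (a - 1)) with (Rpower d0 a * / d0).
    + nra.
    + unfold Rminus. rewrite Rpower_plus, Rpower_Ropp, Rpower_1 by lra. reflexivity.
  - apply Rmult_le_compat_r; [lra|]. apply Rpower_le_nonpos; lra.
Qed.

(** In each row of pairs of levels the losses [1/(h+1)] add up to at most twice a
    harmonic sum, while the kinks all have the same sign. *)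
Lemma lattice_energy_lower_bound a k N :
  0 < a <= 1 -> (4 <= k)%nat -> (N <= 2 * k)%nat ->
  let n := (2 * k)%nat in
  INR (2 * n) * (INR N * (INR N * (a / 16 * Rpower (INR n) (a - 1))
                          - 28 * harmonic n ^ 2)) <=
  sum_n_m (fun i => sum_n_m (fun j =>
    INR (2 * n) * sum_n_m (fun m => (-1) ^ m *
      (lattice_power a (INR (i - j + (j - i))) (INR m)
       - lattice_power a (INR (i - j + (j - i))) (INR (m - 1)))) 1 n) 1 N) 1 N.
Proof.
  intros Ha Hk HN n.
  assert (HH : 1 <= harmonic n) by (apply harmonic_ge_1; unfold n; lia).
  set (q := a / 16 * Rpower (INR n) (a - 1)).
  rewrite <- (Rmult_1_l (INR (2 * n) * _)).
  replace (1 * (INR (2 * n) * (INR N * (INR N * q - 28 * harmonic n ^ 2)))) with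
    (INR N * (INR (2 * n) * (INR N * q - 28 * harmonic n ^ 2))) by ring.
  rewrite <- sum_const. apply sum_le; intros i Hi.
  rewrite sum_mult_l. apply Rmult_le_compat_l; [apply pos_INR|].
  set (phi := fun h => 14 * harmonic n / INR (S h)).
  apply Rle_trans with (sum_n_m (fun j => q + -1 * phi (i - j + (j - i))%nat) 1 N).
  - rewrite sum_add, sum_const, sum_mult_l.
    assert (phi_pos : forall h, 0 <= phi h).
    { intros h. apply Rmult_le_pos; [lra|].
      left; apply Rinv_0_lt_compat, lt_0_INR; lia. }
    pose proof (sum_row_distance_le phi N i phi_pos Hi) as R1.
    assert (R2 : sum_n_m (fun h => phi (h - 1)%nat) 1 N <= 14 * harmonic n * harmonic n).
    { apply Rle_trans with (sum_n_m (fun h => phi (h - 1)%nat) 1 n).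
      - apply sum_le_longer; [intros; apply phi_pos|exact HN].
      - right. unfold harmonic at 2. rewrite <- sum_mult_l.
        apply sum_n_m_ext_loc; intros h Hh. unfold phi.
        replace (S (h - 1)) with h by lia. reflexivity. }
    replace (harmonic n ^ 2) with (harmonic n * harmonic n) by ring. lra.
  - apply sum_le; intros j Hj.
    pose proof (alternating_lattice_power a (i - j + (j - i)) k Ha Hk ltac:(lia)) as E.
    cbv zeta in E. fold n in E. unfold phi, q. lra.
Qed.

(** The weights alternate around every parallel and do not depend on the level,
    so they sum to 0 and the quadratic form must be nonpositive.  It differs from
    the one of the lattice by the error of [grid_distance] in each of the
    [(2 n N)^2] pairs. *)
Lemma negative_definite_energy_bound (r : R -> R) a k N :
  (forall z, 0 <= z -> 0 < r z) ->
  (forall z1 z2, 0 <= z1 -> z1 <= z2 -> r z1 <= r z2) ->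
  smooth_on nonneg_reals r ->
  negative_definite_kernel (revolution_surface r)
    (fun x y => nonneg_power (geodesic_distance (revolution_surface r) x y) a) ->
  0 < a <= 1 -> (4 <= k)%nat -> (N <= 2 * k)%nat ->
  let n := (2 * k)%nat in
  let c := r 0 * (PI / INR n) in
  Rpower c a * (INR (2 * n) * (INR N * (INR N * (a / 16 * Rpower (INR n) (a - 1))
                                        - 28 * harmonic n ^ 2))) <=
  (INR (2 * n) * INR N) ^ 2 *
    (Rpower c (a - 1) * ((PI + 1) * (r (c * INR N) - r 0))).
Proof.
  intros r_pos r_incr r_smooth Hneg Ha Hk HN n c.
  assert (Hn : (1 <= n)%nat) by (unfold n; lia).
  assert (Hr0 : 0 < r 0) by (apply r_pos; lra).
  pose proof PI_RGT_0 as HPI.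
  assert (Hc : 0 < c).
  { apply Rmult_lt_0_compat; [assumption|]. apply Rdiv_lt_0_compat; [assumption|].
    apply lt_0_INR; lia. }
  set (eps := (PI + 1) * (r (c * INR N) - r 0)).
  assert (Heps : 0 <= eps).
  { apply Rmult_le_pos; [lra|]. pose proof (pos_INR N).
    assert (r 0 <= r (c * INR N)) by (apply r_incr; [lra|nra]). lra. }
  set (eta := Rpower c (a - 1) * eps).
  set (d := geodesic_distance (revolution_surface r)) in *.
  set (h := fun i j => (i - j + (j - i))%nat).
  assert (Hpair : forall i j k l, (1 <= i <= N)%nat -> (1 <= j <= N)%nat ->
    (1 <= k <= 2 * n)%nat ->
    Rabs (nonneg_power (d (grid_point r n i k) (grid_point r n j l)) a
          - Rpower c a * lattice_power a (INR (h i j))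
                           (INR (circle_dist n (l + (2 * n - k))))) <= eta).
  { intros i j k' l Hi Hj Hk'. unfold lattice_power.
    destruct (grid_distance r n i j k' l N r_pos r_incr r_smooth Hn) as [Hd Hd0];
      try lia.
    fold d c eps in Hd, Hd0. fold (h i j) in Hd, Hd0.
    set (m := circle_dist n (l + (2 * n - k'))) in *.
    rewrite <- nonneg_power_mult by (assumption || apply sqrt_pos).
    destruct (Nat.eq_dec (m + h i j) 0) as [E|E].
    - assert (Em : m = 0%nat) by lia. assert (Eh : h i j = 0%nat) by lia.
      rewrite (Hd0 Em Eh), Em, Eh. simpl (INR 0).
      replace (0 ^ 2 + 0 ^ 2) with 0 by ring.
      rewrite sqrt_0, Rmult_0_r, Rminus_diag, Rabs_R0.
      apply Rmult_le_pos; [left; apply Rpower_pos|assumption].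
    - apply nonneg_power_perturbation; [assumption| |assumption].
      split; [assumption|]. rewrite <- (Rmult_1_r c) at 1.
      apply Rmult_le_compat_l; [lra|]. rewrite <- sqrt_1. apply sqrt_le_1_alt.
      assert (H : 1 <= INR m + INR (h i j)).
      { rewrite <- plus_INR. change 1 with (INR 1). apply le_INR; lia. }
      assert (INR m = 0 \/ 1 <= INR m) as [Z|Z].
      { destruct m; [left; reflexivity|right]. change 1 with (INR 1). apply le_INR; lia. }
      + rewrite Z in *. nra.
      + assert (0 <= INR (h i j) ^ 2) by apply pow2_ge_0. nra. }
  assert (Hneg' := negative_definite_kernel_array _ _ N (2 * n) (grid_point r n)
                     (fun _ k => (-1) ^ k) Hneg ltac:(lia)).
  assert (Hsum : sum_n_m (fun k => (-1) ^ k) 1 (2 * n) = 0).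
  { clear. induction n as [|n IH]; [apply sum_empty|].
    replace (2 * S n)%nat with (S (S (2 * n))) by lia.
    rewrite !sum_first_last, IH, <- !tech_pow_Rmult. ring_R. }
  cbv beta in Hneg'. rewrite Hsum, sum_const, Rmult_0_r in Hneg'.
  assert (Hgrid : forall i k, (1 <= i <= N)%nat -> (1 <= k <= 2 * n)%nat ->
            revolution_surface r (grid_point r n i k)).
  { intros i k' _ _. unfold grid_point. eexists; eexists; split; [|reflexivity].
    fold c. apply Rmult_le_pos; [lra|apply pos_INR]. }
  specialize (Hneg' Hgrid eq_refl).
  rewrite (sum_n_m_ext _ (fun i => sum_n_m (fun j => sum_n_m (fun k => sum_n_m (fun l =>
      (-1) ^ k * (-1) ^ l * nonneg_power (d (grid_point r n i k) (grid_point r n j l)) a)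
    1 (2 * n)) 1 (2 * n)) 1 N)) in Hneg' by (intros i; apply sum_exchange).
  assert (Hlow : sum_n_m (fun i => sum_n_m (fun j => sum_n_m (fun k => sum_n_m (fun l =>
      Rpower c a * ((-1) ^ k * (-1) ^ l * lattice_power a (INR (h i j))
                           (INR (circle_dist n (l + (2 * n - k))))) + - eta)
    1 (2 * n)) 1 (2 * n)) 1 N) 1 N <= 0).
  { eapply Rle_trans; [|exact Hneg'].
    apply sum_le; intros i Hi. apply sum_le; intros j Hj.
    apply sum_le; intros k' Hk'. apply sum_le; intros l Hl.
    specialize (Hpair i j k' l Hi Hj Hk').
    rewrite <- pow_add.
    assert (Hs : (-1) ^ (k' + l) = 1 \/ (-1) ^ (k' + l) = -1).
    { generalize (k' + l)%nat as t. clear. intros t. induction t as [|t [IH|IH]].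
      - left; reflexivity.
      - right. rewrite <- tech_pow_Rmult, IH; ring.
      - left. rewrite <- tech_pow_Rmult, IH; ring. }
    apply Rabs_le_between in Hpair. destruct Hs as [-> | ->]; lra. }
  assert (E : sum_n_m (fun i => sum_n_m (fun j => sum_n_m (fun k => sum_n_m (fun l =>
      Rpower c a * ((-1) ^ k * (-1) ^ l * lattice_power a (INR (h i j))
                           (INR (circle_dist n (l + (2 * n - k))))) + - eta)
    1 (2 * n)) 1 (2 * n)) 1 N) 1 N =
    Rpower c a * sum_n_m (fun i => sum_n_m (fun j =>
      INR (2 * n) * sum_n_m (fun m => (-1) ^ m *
      (lattice_power a (INR (h i j)) (INR m)
       - lattice_power a (INR (h i j)) (INR (m - 1)))) 1 n) 1 N) 1 N
    + - ((INR (2 * n) * INR N) ^ 2 * eta)).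
  { transitivity (sum_n_m (fun i => Rpower c a * sum_n_m (fun j =>
      INR (2 * n) * sum_n_m (fun m => (-1) ^ m *
      (lattice_power a (INR (h i j)) (INR m)
       - lattice_power a (INR (h i j)) (INR (m - 1)))) 1 n) 1 N
       + - (INR (2 * n) ^ 2 * INR N * eta)) 1 N).
    - apply sum_n_m_ext; intros i.
      transitivity (sum_n_m (fun j =>
        Rpower c a * (INR (2 * n) * sum_n_m (fun m => (-1) ^ m *
         (lattice_power a (INR (h i j)) (INR m)
          - lattice_power a (INR (h i j)) (INR (m - 1)))) 1 n)
          + - (INR (2 * n) ^ 2 * eta)) 1 N).
      + apply sum_n_m_ext; intros j.
        rewrite <- (sum_circle_pairs (fun m => lattice_power a (INR (h i j)) (INR m))).
        rewrite <- sum_mult_l.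
        transitivity (sum_n_m (fun k => Rpower c a * sum_n_m (fun l =>
           (-1) ^ k * (-1) ^ l * lattice_power a (INR (h i j))
              (INR (circle_dist n (l + (2 * n - k))))) 1 (2 * n)
           + - (INR (2 * n) * eta)) 1 (2 * n)).
        * apply sum_n_m_ext; intros k'. rewrite sum_add, sum_const, sum_mult_l. ring_R.
        * rewrite sum_add, sum_const. ring_R.
      + rewrite sum_add, sum_const, sum_mult_l. ring_R.
    - rewrite sum_add, sum_const, sum_mult_l. ring_R. }
  rewrite E in Hlow.
  pose proof (lattice_energy_lower_bound a k N Ha Hk HN) as L.
  cbv zeta in L. fold n in L.
  apply (Rmult_le_compat_l (Rpower c a)) in L; [|left; apply Rpower_pos].
  fold eta. unfold h in Hlow. lra.
Qed.

(** * Letting the mesh tend to zero *)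

Lemma Rpower_eventually_large e M :
  0 < e -> exists x0, forall x, x0 <= x -> M < Rpower x e.
Proof.
  intros He. set (M' := Rmax M 1).
  assert (HM : 1 <= M') by apply Rmax_r.
  exists (Rpower (M' + 1) (/ e)). intros x Hx.
  apply Rlt_le_trans with (Rpower (Rpower (M' + 1) (/ e)) e).
  - rewrite Rpower_mult, Rinv_l, Rpower_1 by lra.
    pose proof (Rmax_l M 1). fold M' in H. lra.
  - apply Rle_Rpower_l; [lra|]. split; [apply Rpower_pos|assumption].
Qed.

(** The balance of exponents: with a mesh of [1/n] and [N] of order [n^(1-a/2)]
    levels the grid has height of order [n^(-a/2)], so the error per pair,
    relative to the size of the kink, is of order [n^(3-a) n^(-ap/2)]. *)
Lemma not_negative_definite_of_flat (r : R -> R) p a C z0 :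
  (forall z, 0 <= z -> 0 < r z) ->
  (forall z1 z2, 0 <= z1 -> z1 <= z2 -> r z1 <= r z2) ->
  smooth_on nonneg_reals r ->
  0 < p -> 0 < a <= 1 -> 6 < a * (p + 2) -> 0 < z0 ->
  (forall z, 0 < z < z0 -> r z - r 0 <= C * Rpower z p) ->
  ~ negative_definite_kernel (revolution_surface r)
      (fun x y => nonneg_power (geodesic_distance (revolution_surface r) x y) a).
Proof.
  intros r_pos r_incr r_smooth Hp Ha Hap Hz0 Hflat Hneg.
  assert (Hr0 : 0 < r 0) by (apply r_pos; lra).
  pose proof PI_RGT_0 as HPI.
  assert (HC : 0 <= C).
  { specialize (Hflat (z0 / 2) ltac:(lra)).
    assert (r 0 <= r (z0 / 2)) by (apply r_incr; lra).
    pose proof (Rpower_pos (z0 / 2) p). nra. }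
  set (e := a * p / 2 + a - 3). assert (He : 0 < e) by (unfold e; nra).
  set (K := (PI + 1) * (C * Rpower (2 * (r 0 * PI)) p)).
  assert (HK : 0 <= K).
  { apply Rmult_le_pos; [lra|]. apply Rmult_le_pos; [assumption|left; apply Rpower_pos]. }
  assert (Hr0PI : 0 < r 0 * PI) by now apply Rmult_lt_0_compat.
  assert (Hq : 0 < r 0 * PI * (a / 64)) by (apply Rmult_lt_0_compat; lra).
  destruct (Rpower_eventually_large (a / 2) 2) as [x1 H1]; [lra|].
  destruct (Rpower_eventually_large (a / 4) (28 * (/ (a / 8)) ^ 2 * (32 / a)))
    as [x2 H2]; [lra|].
  destruct (Rpower_eventually_large (a / 2) (2 * (r 0 * PI) / z0)) as [x3 H3]; [lra|].
  destruct (Rpower_eventually_large e (K / (r 0 * PI * (a / 64)))) as [x4 H4]; [assumption|].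
  destruct (nfloor_ex (Rmax 0 (Rmax (Rmax x1 x2) (Rmax x3 x4)))) as [k0 [_ Hk0]];
    [apply Rmax_l|].
  set (k := (k0 + 4)%nat). set (n := (2 * k)%nat). set (v := INR n).
  assert (Hv : INR k0 + 1 <= v).
  { unfold v. rewrite <- S_INR. apply le_INR. unfold n, k; lia. }
  assert (Hv8 : 8 <= v).
  { unfold v. replace 8 with (INR 8) by (simpl; ring). apply le_INR; unfold n, k; lia. }
  assert (Hx : x1 <= v /\ x2 <= v /\ x3 <= v /\ x4 <= v).
  { pose proof (Rmax_r 0 (Rmax (Rmax x1 x2) (Rmax x3 x4))).
    pose proof (Rmax_l (Rmax x1 x2) (Rmax x3 x4)).
    pose proof (Rmax_r (Rmax x1 x2) (Rmax x3 x4)).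
    pose proof (Rmax_l x1 x2). pose proof (Rmax_r x1 x2).
    pose proof (Rmax_l x3 x4). pose proof (Rmax_r x3 x4). lra. }
  specialize (H1 v ltac:(tauto)). specialize (H2 v ltac:(tauto)).
  specialize (H3 v ltac:(tauto)). specialize (H4 v ltac:(tauto)).
  clear Hx Hk0.
  set (y := Rpower v (1 - a / 2)).
  assert (Hy1 : 1 <= y).
  { apply Rle_trans with (Rpower v 0); [rewrite Rpower_O; lra|].
    apply Rle_Rpower; lra. }
  destruct (nfloor_ex y) as [N0 HN0]; [lra|].
  set (N := S N0).
  assert (HN : y <= INR N <= 2 * y) by (unfold N; rewrite S_INR; lra).
  assert (Evv : y * Rpower v (a / 2) = v).
  { unfold y. rewrite <- Rpower_plus.
    replace (1 - a / 2 + a / 2) with 1 by ring. apply Rpower_1; lra. }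
  assert (HNn : (N <= 2 * k)%nat).
  { apply INR_le. fold n v. apply Rle_trans with (2 * y); [lra|]. rewrite <- Evv. nra. }
  pose proof (negative_definite_energy_bound r a k N r_pos r_incr r_smooth Hneg Ha
                ltac:(unfold k; lia) HNn) as B.
  cbv zeta in B. fold n v in B.
  set (c := r 0 * (PI / v)) in *.
  assert (Hc : 0 < c) by (apply Rmult_lt_0_compat; [|apply Rdiv_lt_0_compat]; lra).
  set (w := Rpower v (a - 1)) in *.
  assert (Hw : 0 < w) by apply Rpower_pos.
  (* half of the kink term absorbs the harmonic sums *)
  assert (Hharm : 28 * harmonic n ^ 2 <= INR N * (a / 32 * w)).
  { apply Rle_trans with (28 * (/ (a / 8) * Rpower v (a / 8)) ^ 2).
    - apply Rmult_le_compat_l; [lra|]. apply pow_incr. split.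
      + pose proof (harmonic_ge_1 n ltac:(unfold n, k; lia)). lra.
      + apply harmonic_le_power; [unfold n, k; lia|lra].
    - rewrite Rpow_mult_distr, <- (Rpower_pow 2 (Rpower v _)), Rpower_mult by apply Rpower_pos.
      replace (a / 8 * INR 2) with (a / 4) by (simpl; field).
      apply Rle_trans with (y * (a / 32 * w)).
      + assert (Ew : y * w = Rpower v (a / 4) * Rpower v (a / 4)).
        { unfold y, w. rewrite <- !Rpower_plus. f_equal. field. }
        replace (y * (a / 32 * w)) with (a / 32 * (y * w)) by ring. rewrite Ew.
        apply Rle_trans with
          (a / 32 * (28 * (/ (a / 8)) ^ 2 * (32 / a) * Rpower v (a / 4))).
        * right. field. lra.
        * apply Rmult_le_compat_l; [lra|]. apply Rmult_le_compat_r; [|lra].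
          left; apply Rpower_pos.
      + apply Rmult_le_compat_r; [|lra].
        apply Rmult_le_pos; [lra|left; assumption]. }
  assert (HcN : c * INR N <= 2 * (r 0 * PI) * Rpower v (- (a / 2))).
  { apply Rle_trans with (c * (2 * y)); [apply Rmult_le_compat_l; lra|].
    right. unfold c. rewrite <- Evv at 1. rewrite Rpower_Ropp.
    field. split; [|lra]. pose proof (Rpower_pos v (a / 2)). lra. }
  assert (HN0R : 0 < INR N) by lra.
  assert (HcN0 : 0 < c * INR N) by (apply Rmult_lt_0_compat; assumption).
  assert (Hlow : c * INR N < z0).
  { eapply Rle_lt_trans; [exact HcN|]. rewrite Rpower_Ropp.
    pose proof (Rpower_pos v (a / 2)) as P.
    apply Rmult_lt_reg_r with (Rpower v (a / 2)); [assumption|].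
    rewrite Rmult_assoc, Rinv_l, Rmult_1_r by lra.
    apply Rmult_lt_compat_r with (r := z0) in H3; [|assumption].
    unfold Rdiv in H3. rewrite Rmult_assoc, Rinv_l, Rmult_1_r in H3 by lra. lra. }
  assert (Heps : (PI + 1) * (r (c * INR N) - r 0) <= K * Rpower v (- (a * p / 2))).
  { unfold K. rewrite Rmult_assoc. apply Rmult_le_compat_l; [lra|].
    eapply Rle_trans; [apply Hflat; split; assumption|].
    rewrite Rmult_assoc. apply Rmult_le_compat_l; [assumption|].
    apply Rle_trans with (Rpower (2 * (r 0 * PI) * Rpower v (- (a / 2))) p).
    - apply Rle_Rpower_l; [lra|]. split; assumption.
    - rewrite <- Rpower_mult_distr by (apply Rpower_pos || nra).
      rewrite Rpower_mult. right. do 2 f_equal. field. }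
  set (eps := (PI + 1) * (r (c * INR N) - r 0)) in *.
  (* dividing the energy bound by 2 n N^2 c^(a-1) *)
  assert (Hcore : c * (a / 32 * w) <= 2 * v * eps).
  { pose proof (Rpower_pos c (a - 1)) as P.
    assert (Eca : Rpower c a = Rpower c (a - 1) * c).
    { rewrite <- (Rpower_1 c) at 3 by assumption. rewrite <- Rpower_plus.
      f_equal; ring. }
    rewrite Eca, mult_INR in B. fold v in B. simpl (INR 2) in B.
    apply Rmult_le_reg_l with (Rpower c (a - 1) * (2 * v) * INR N ^ 2).
    - repeat apply Rmult_lt_0_compat; lra.
    - eapply Rle_trans; [|eapply Rle_trans; [exact B|right; ring]].
      replace (Rpower c (a - 1) * (2 * v) * INR N ^ 2 * (c * (a / 32 * w))) with
        (Rpower c (a - 1) * c * (2 * v * (INR N * (INR N * (a / 32 * w))))) by ring.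
      apply Rmult_le_compat_l; [apply Rmult_le_pos; lra|].
      apply Rmult_le_compat_l; [lra|]. apply Rmult_le_compat_l; [lra|]. lra. }
  assert (Hfin : K < r 0 * PI * (a / 64) * Rpower v e).
  { apply Rmult_lt_compat_r with (r := r 0 * PI * (a / 64)) in H4; [|assumption].
    unfold Rdiv in H4 at 1. rewrite Rmult_assoc, Rinv_l, Rmult_1_r in H4 by lra. lra. }
  assert (Hcore' : r 0 * PI * (a / 64) * w <= v ^ 2 * eps).
  { apply Rmult_le_reg_l with (2 / v); [apply Rdiv_lt_0_compat; lra|].
    replace (2 / v * (v ^ 2 * eps)) with (2 * v * eps) by (field; lra).
    eapply Rle_trans; [|exact Hcore]. right. unfold c. field. lra. }
  assert (Ee : v ^ 2 * Rpower v (- (a * p / 2)) * Rpower v e = w).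
  { rewrite <- (Rpower_pow 2), <- !Rpower_plus by lra. unfold w, e. f_equal.
    simpl. field. }
  pose proof (Rpower_pos v (- (a * p / 2))) as P.
  assert (Hv2 : 0 < v ^ 2) by (apply pow_lt; lra).
  assert (v ^ 2 * eps <= v ^ 2 * Rpower v (- (a * p / 2)) * K).
  { rewrite Rmult_assoc. apply Rmult_le_compat_l; lra. }
  assert (v ^ 2 * Rpower v (- (a * p / 2)) * K <
          v ^ 2 * Rpower v (- (a * p / 2)) * (r 0 * PI * (a / 64) * Rpower v e)).
  { apply Rmult_lt_compat_l; [|assumption]. apply Rmult_lt_0_compat; assumption. }
  rewrite <- Ee in Hcore'. lra.
Qed.

Lemma flat_of_little_o (r : R -> R) p c :
  little_o_at_0 (fun z => r z - r 0 - c * Rpower z p) (fun z => Rpower z p) ->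
  exists z0, 0 < z0 /\
    forall z, 0 < z < z0 -> r z - r 0 <= (Rabs c + 1) * Rpower z p.
Proof.
  intros Ho. destruct (Ho (mkposreal 1 Rlt_0_1)) as [z0 H].
  exists z0; split; [apply cond_pos|]. intros z Hz.
  specialize (H z). simpl in H.
  assert (B : Rabs (z - 0) < z0) by (rewrite Rminus_0_r, Rabs_right; lra).
  specialize (H B ltac:(lra)). unfold norm in H; simpl in H. unfold abs in H; simpl in H.
  pose proof (Rpower_pos z p) as P.
  rewrite (Rabs_right (Rpower z p)), Rmult_1_l in H by lra.
  apply Rabs_le_between in H. pose proof (Rle_abs c). nra.
Qed.

(** One exponent suffices: the index bounds all exponents of negative definite
    powers, so a larger index would allow some [a <= 1] with [a (p + 2) > 6]. *)
Lemma fractional_index_bound (r : R -> R) beta p c :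
  (forall z, 0 <= z -> 0 < r z) ->
  (forall z1 z2, 0 <= z1 -> z1 <= z2 -> r z1 <= r z2) ->
  smooth_on nonneg_reals r ->
  is_fractional_index (revolution_surface r)
    (geodesic_distance (revolution_surface r)) beta ->
  4 < p ->
  little_o_at_0 (fun z => r z - r 0 - c * Rpower z p) (fun z => Rpower z p) ->
  Rbar_le beta (6 / (p + 2)).
Proof.
  intros r_pos r_incr r_smooth [_ Hbeta] Hp Ho.
  destruct (Rbar_le_lt_dec beta (6 / (p + 2))) as [H|H]; [exact H|exfalso].
  assert (Hlt1 : 6 / (p + 2) < 1).
  { apply Rmult_lt_reg_r with (p + 2); [lra|]. unfold Rdiv.
    rewrite Rmult_assoc, Rinv_l by lra. lra. }
  assert (exists a, 6 / (p + 2) < a <= 1 /\ Rbar_le a beta) as (a & Ha & Hab).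
  { destruct beta as [b| |]; simpl in H.
    - exists (Rmin b 1). split; [split|].
      + now apply Rmin_glb_lt.
      + apply Rmin_r.
      + apply Rmin_l.
    - exists 1. split; [lra|exact I].
    - contradiction. }
  assert (0 < 6 / (p + 2)) by (apply Rdiv_lt_0_compat; lra).
  destruct (flat_of_little_o r p c Ho) as (z0 & Hz0 & Hflat).
  apply (not_negative_definite_of_flat r p a (Rabs c + 1) z0); auto; try lra.
  - destruct Ha as [Ha _]. apply Rmult_lt_compat_r with (r := p + 2) in Ha; [|lra].
    unfold Rdiv in Ha. rewrite Rmult_assoc, Rinv_l in Ha by lra. lra.
  - replace a with (2 * (a / 2)) by field. apply Hbeta; [lra|].
    replace (2 * (a / 2)) with a by field. exact Hab.
Qed.

Theorem theorem5 (r : R -> R)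
  (r_pos : forall z, 0 <= z -> 0 < r z)
  (r_incr : forall z1 z2, 0 <= z1 -> z1 <= z2 -> r z1 <= r z2)
  (r_smooth : smooth_on nonneg_reals r)
  (beta : Rbar)
  (beta_index : is_fractional_index (revolution_surface r)
     (geodesic_distance (revolution_surface r)) beta) :
  (forall p c : R, 4 < p ->
     little_o_at_0 (fun z => r z - r 0 - c * Rpower z p)
                   (fun z => Rpower z p) ->
     Rbar_le beta (6 / (p + 2))) /\
  ((forall p : nat, little_o_at_0 (fun z => r z - r 0) (fun z => z ^ p)) ->
     beta = Finite 0).
Proof.
  split.
  - intros p c. now apply fractional_index_bound.
  - intros Ho.
    assert (Hle : forall q, (5 <= q)%nat -> Rbar_le beta (6 / (INR q + 2))).
    { intros q Hq. apply (fractional_index_bound r beta (INR q) 0); auto.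
      - apply Rlt_le_trans with (INR 5); [simpl; lra|now apply le_INR].
      - intros eps. specialize (Ho q eps). destruct Ho as [z0 H]. exists z0.
        intros z Bz Hz. specialize (H z Bz Hz).
        rewrite Rpower_pow by exact Hz. rewrite Rmult_0_l, Rminus_0_r. exact H. }
    destruct beta_index as [H0 _].
    destruct beta as [b| |]; simpl in H0.
    + f_equal. apply Rle_antisym; [|exact H0].
      apply Rnot_lt_le. intros Hb.
      destruct (nfloor_ex (6 / b)) as [q Hq]; [left; apply Rdiv_lt_0_compat; lra|].
      specialize (Hle (q + 5)%nat ltac:(lia)). simpl in Hle.
      rewrite plus_INR in Hle. simpl (INR 5) in Hle. pose proof (pos_INR q).
      destruct Hq as [_ Hq].
      apply Rmult_lt_compat_r with (r := b) in Hq; [|assumption].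
      unfold Rdiv in Hq. rewrite Rmult_assoc, Rinv_l in Hq by lra.
      apply Rmult_le_compat_r with (r := INR q + (1 + 1 + 1 + 1 + 1) + 2) in Hle; [|lra].
      unfold Rdiv in Hle. rewrite Rmult_assoc, Rinv_l in Hle by lra. nra.
    + destruct (Hle 5%nat (le_n 5)).
    + contradiction.
Qed.
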